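(* Let $(\Omega,\Sigma,\mathbb{P})$ be a nonatomic probability space. Let $(X_n)_{n=1}^\infty$ be a bounded sequence in $\mathbb{L}^1_+(\mathbb{P})$ and let $\mathcal{K}=\operatorname{co}(X_n)_{n=1}^\infty$ be the convex hull of $\{X_n:n\in\mathbb{N}\}$. The following are equivalent. (1) The $\mathbb{L}^0(\mathbb{P})$-topology is locally convex on $\mathcal{K}$. (2) There exists a probability measure $\mathbb{Q}\sim\mathbb{P}$ such that the $\mathbb{L}^0(\mathbb{Q})$- and $\mathbb{L}^1(\mathbb{Q})$-topologies agree on $\mathcal{K}$.
   Context: $\mathbb{L}^0(\mathbb{P})$ is the space of all real random variables on $(\Omega,\Sigma)$ modulo a.s. equality; the $\mathbb{L}^0(\mathbb{P})$-topology is the topology of convergence in probability. $\mathbb{L}^1_+(\mathbb{P})$ is the set of a.s. nonnegative elements of $\mathbb{L}^1(\mathbb{P})$; bounded means bounded in the $\mathbb{L}^1(\mathbb{P})$-norm. The (relative) $\mathbb{L}^0(\mathbb{P})$-topology on a convex set $\mathcal{K}$ is locally convex at $X\in\mathcal{K}$ if for every $\mathbb{L}^0(\mathbb{P})$-neighborhood $\mathcal{U}$ of $0$ there is a convex neighborhood $\mathcal{W}$ of $X$ in the relative $\mathbb{L}^0(\mathbb{P})$-topology on $\mathcal{K}$ with $\mathcal{W}\subset (X+\mathcal{U})\cap\mathcal{K}$; it is locally convex on $\mathcal{K}$ if this holds at every $X\in\mathcal{K}$. $\mathbb{Q}\sim\mathbb{P}$ means that $\mathbb{Q}$ is a probability measure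 on $(\Omega,\Sigma)$ mutually absolutely continuous with $\mathbb{P}$. That the $\mathbb{L}^0(\mathbb{Q})$- and $\mathbb{L}^1(\mathbb{Q})$-topologies agree on $\mathcal{K}$ means that $\mathcal{K}\subseteq\mathbb{L}^1(\mathbb{Q})$ and the relative topologies on $\mathcal{K}$ inherited from $\mathbb{L}^0(\mathbb{Q})$ and from the norm of $\mathbb{L}^1(\mathbb{Q})$ coincide. *)

(* Defs.v *)
From HB Require Import structures.
From mathcomp Require Import all_boot all_order all_algebra.
From mathcomp Require Import generic_quotient.
From mathcomp Require Import all_classical all_reals all_analysis.
(* all_analysis alone does not export the ring structure of {mfun T >-> R} *)
From mathcomp Require Import measurable_realfun.

Set Implicit Arguments.
Unset Strict Implicit.
Unset Printing Implicit Defensive.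

Import Order.TTheory GRing.Theory Num.Theory.
Import numFieldNormedType.Exports.

Local Open Scope classical_set_scope.
Local Open Scope ring_scope.
Local Open Scope quotient_scope.

Definition nonatomic d (T : measurableType d) (R : realType)
    (P : probability T R) : Prop :=
  forall A, measurable A -> (0 < P A)%E ->
    exists B, [/\ measurable B, B `<=` A & (0 < P B < P A)%E].

Definition convex_hull (R : numDomainType) (M : lmodType R) (A : set M) :
    set M :=
  smallest (@convex_set R M) A.

(* Random variables modulo P-a.s. equality. *)
Definition L0 d (T : measurableType d) (R : realType) (P : probability T R) :
  Type := {mfun_ P, T >-> R}.

Section L0_lmodType.
Context d (T : measurableType d) (R : realType) (P : probability T R).

HB.instance Definition _ := Choice.on (L0 P).
HB.instance Definition _ := EqQuotient.on (L0 P).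

Definition L0_fun (f : L0 P) : T -> R := repr f.
Coercion L0_fun : L0 >-> Funclass.

Implicit Types (f g : {mfun T >-> R}) (x y z : L0 P) (a : R).

Definition L0_pi f : L0 P := \pi f.

Lemma L0_piP f g : L0_pi f = L0_pi g <-> f = g %[ae P].
Proof.
split; first by move=> /eqmodP/asboolP.
by move=> h; apply/eqmodP/asboolP.
Qed.

Lemma L0_reprK x : L0_pi (repr x) = x.
Proof. exact: reprK. Qed.

Lemma L0_piE f : L0_pi f = f %[ae P].
Proof. by apply/L0_piP; rewrite L0_reprK. Qed.

Lemma L0_eqP x y : x = y <-> x = y %[ae P].
Proof. by rewrite -{1}(L0_reprK x) -{1}(L0_reprK y) L0_piP. Qed.

Definition L0_zero : L0 P := L0_pi 0.
Definition L0_opp x : L0 P := L0_pi (- repr x).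
Definition L0_add x y : L0 P := L0_pi (repr x + repr y).
Definition L0_scale a x : L0 P := L0_pi (a *: repr x).

Lemma L0_piD f g : L0_add (L0_pi f) (L0_pi g) = L0_pi (f + g).
Proof.
apply/L0_piP; move: (L0_piE f) (L0_piE g).
by apply: filterS2 => t /(_ I) fE /(_ I) gE _; exact: (congr2 +%R fE gE).
Qed.

Lemma L0_piN f : L0_opp (L0_pi f) = L0_pi (- f).
Proof.
apply/L0_piP; move: (L0_piE f).
by apply: filterS => t /(_ I) fE _; exact: (congr1 -%R fE).
Qed.

Lemma L0_piZ a f : L0_scale a (L0_pi f) = L0_pi (a *: f).
Proof.
apply/L0_piP; move: (L0_piE f).
by apply: filterS => t /(_ I) fE _; exact: (congr1 ( *:%R a) fE).
Qed.

Let addA : associative L0_add.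
Proof.
move=> x y z; rewrite -(L0_reprK x) -(L0_reprK y) -(L0_reprK z).
by rewrite !L0_piD addrA.
Qed.

Let addC : commutative L0_add.
Proof. by move=> x y; rewrite /L0_add addrC. Qed.

Let add0 : left_id L0_zero L0_add.
Proof. by move=> x; rewrite -(L0_reprK x) L0_piD add0r. Qed.

Let addN : left_inverse L0_zero L0_opp L0_add.
Proof. by move=> x; rewrite -(L0_reprK x) L0_piN L0_piD addNr. Qed.

HB.instance Definition _ := GRing.isZmodule.Build (L0 P) addA addC add0 addN.

Let scaleA a b x : L0_scale a (L0_scale b x) = L0_scale (a * b) x.
Proof. by rewrite -(L0_reprK x) !L0_piZ scalerA. Qed.

Let scale1 : left_id 1 L0_scale.
Proof. by move=> x; rewrite -(L0_reprK x) L0_piZ scale1r. Qed.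

Let scaleDr : right_distributive L0_scale +%R.
Proof.
move=> a x y; rewrite -(L0_reprK x) -(L0_reprK y).
by rewrite [X in L0_scale a X]L0_piD !L0_piZ [RHS]L0_piD scalerDr.
Qed.

Let scaleDl x : {morph L0_scale^~ x : a b / a + b}.
Proof.
by move=> a b; rewrite -(L0_reprK x) !L0_piZ [RHS]L0_piD scalerDl.
Qed.

HB.instance Definition _ := GRing.Zmodule_isLmodule.Build R (L0 P)
  scaleA scale1 scaleDr scaleDl.

End L0_lmodType.

Section L0_topology.
Context d (T : measurableType d) (R : realType) (P : probability T R).
Implicit Types (f g h : L0 P) (e : R).

(* Ky Fan pseudometric; L0_cvgP below shows that it induces convergence in
   probability. *)
Definition L0_ball f e g : Prop :=
  (P [set t | (e <= `|f t - g t|)%R] < e%:E)%E.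

Lemma measurable_L0_dist f g e : measurable [set t | e <= `|f t - g t|].
Proof.
rewrite -[X in measurable X]setTI.
have : measurable_fun setT (fun t => `|f t - g t|).
  by apply: measurableT_comp => //; exact: measurable_funB.
move=> /(_ measurableT `[e, +oo[%classic (measurable_itv _)).
by congr measurable; apply/seteqP; split => t /=; rewrite in_itv/= andbT.
Qed.

Let center f e : 0 < e -> L0_ball f e f.
Proof.
move=> e0; rewrite /L0_ball [X in P X](_ : _ = set0) ?measure0 ?lte_fin//.
by apply/seteqP; split => t //=; rewrite subrr normr0 leNgt e0.
Qed.

Let sym f g e : L0_ball f e g -> L0_ball g e f.
Proof.
by rewrite /L0_ball; under [in X in X -> _]eq_set do rewrite distrC.
Qed.

Let triangle f g h e1 e2 :
  L0_ball f e1 g -> L0_ball g e2 h -> L0_ball f (e1 + e2) h.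
Proof.
rewrite /L0_ball => fg gh; rewrite EFinD.
apply: le_lt_trans (lteD fg gh).
apply: le_trans (measureU2 _ _ _); try exact: measurable_L0_dist.
apply: le_measure; rewrite ?inE; try exact: measurable_L0_dist.
  by apply: measurableU; exact: measurable_L0_dist.
move=> t /= efh; apply: contrapT => /not_orP[/negP + /negP].
rewrite -!ltNge => fg' gh'; move: efh; apply/negP; rewrite -ltNge.
rewrite (_ : f t - h t = (f t - g t) + (g t - h t)); last by rewrite subrKA.
by rewrite (le_lt_trans (ler_normD _ _))// ltrD.
Qed.

HB.instance Definition _ := hasNbhs.Build (L0 P) (nbhs_ (entourage_ L0_ball)).
HB.instance Definition _ := Nbhs_isPseudoMetric.Build R (L0 P)
  erefl center sym triangle erefl.

Lemma L0_cvgP (u : nat -> L0 P) f : u @ \oo --> f <->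
  forall e, 0 < e -> P [set t | e <= `|f t - u n t|] @[n --> \oo] --> 0%E.
Proof.
split.
- move=> uf e e0; apply/fine_cvgP; split.
    by apply: nearW => n; rewrite fin_num_measure//; exact: measurable_L0_dist.
  apply/cvgrPdist_lt => r r0 /=.
  have m0 : 0 < Order.min e r by rewrite lt_min e0.
  have /cvg_ball/(_ _ m0) := uf.
  apply: filterS => n; rewrite /ball/= /L0_ball => h.
  rewrite sub0r normrN ger0_norm ?fine_ge0//.
  rewrite -lte_fin fineK ?fin_num_measure//; last exact: measurable_L0_dist.
  apply: le_lt_trans (lt_le_trans h _); last by rewrite lee_fin ge_min lexx orbT.
  apply: le_measure; rewrite ?inE; try exact: measurable_L0_dist.
  by move=> t /=; apply: le_trans; rewrite ge_min lexx.
- move=> h; apply/cvg_ballP => e e0.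
  have /fine_cvgP[_ /cvgrPdist_lt/(_ _ e0)] := h _ e0.
  apply: filterS => n; rewrite /ball/= /L0_ball.
  rewrite sub0r normrN ger0_norm ?fine_ge0//.
  by rewrite -lte_fin fineK ?fin_num_measure//; exact: measurable_L0_dist.
Qed.

End L0_topology.

Definition L1 d (T : measurableType d) (R : realType) (P : probability T R) :
  Type := {f : L0 P | (f : T -> R) \in Lfun P 1}.

Section L1.
Context d (T : measurableType d) (R : realType) (P : probability T R).
Implicit Types (f g h : L1 P) (e : R).

HB.instance Definition _ := Choice.on (L1 P).

Definition L1_L0 (f : L1 P) : L0 P := val f.
Coercion L1_L0 : L1 >-> L0.

Definition L1_ball f e g : Prop :=
  ('N[P]_1[EFin \o (f \- g)%R] < e%:E)%E.

Let center f e : 0 < e -> L1_ball f e f.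
Proof.
move=> e0; rewrite /L1_ball Lnorm1.
by under eq_integral do rewrite /= subrr normr0; rewrite integral0 lte_fin.
Qed.

Let sym f g e : L1_ball f e g -> L1_ball g e f.
Proof.
rewrite /L1_ball !Lnorm1.
by under eq_integral do rewrite /= distrC.
Qed.

Let triangle f g h e1 e2 :
  L1_ball f e1 g -> L1_ball g e2 h -> L1_ball f (e1 + e2) h.
Proof.
rewrite /L1_ball => fg gh; rewrite EFinD.
apply: le_lt_trans (lteD fg gh).
rewrite (_ : f \- h = (f \- g) \+ (g \- h)); last first.
  by apply/funext => t /=; rewrite subrKA.
by apply: eminkowski => //; exact: measurable_funB.
Qed.

HB.instance Definition _ := hasNbhs.Build (L1 P) (nbhs_ (entourage_ L1_ball)).
HB.instance Definition _ := Nbhs_isPseudoMetric.Build R (L1 P)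
  erefl center sym triangle erefl.

Lemma L1_cvgP (u : nat -> L1 P) f : u @ \oo --> f <->
  ('N[P]_1[EFin \o (f \- u n)%R])%E @[n --> \oo] --> 0%E.
Proof.
have nge0 n : (0 <= 'N[P]_1[EFin \o (f \- u n)%R])%E by exact: Lnorm_ge0.
split.
- move=> uf; apply/fine_cvgP; split.
    have /cvg_ball/(_ _ ltr01) := uf.
    apply: filterS => n; rewrite /ball/= /L1_ball => h.
    by rewrite ge0_fin_numE// (lt_trans h) ?ltry.
  apply/cvgrPdist_lt => r r0 /=.
  have /cvg_ball/(_ _ r0) := uf.
  apply: filterS => n; rewrite /ball/= /L1_ball => h.
  rewrite sub0r normrN ger0_norm ?fine_ge0//.
  by rewrite -lte_fin fineK// ge0_fin_numE// (lt_trans h) ?ltry.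
- move=> /fine_cvgP[fin /cvgrPdist_lt h]; apply/cvg_ballP => e e0.
  move: fin (h _ e0); apply: filterS2 => n; rewrite /ball/= /L1_ball => fn.
  rewrite sub0r normrN ger0_norm ?fine_ge0//.
  by rewrite -lte_fin fineK.
Qed.

End L1.

Section local_convexity.
Context d (T : measurableType d) (R : realType) (P : probability T R).

(* A neighbourhood of x in the relative topology on K is a subset W of K such
   that within K (nbhs x) W; here W `<=` K is part of the last clause. *)
Definition L0_locally_convex_at (K : set (L0 P)) (x : L0 P) : Prop :=
  forall U : set (L0 P), nbhs (0 : L0 P) U ->
    exists W : set (L0 P), [/\ convex_set W, within K (nbhs x) W &
      W `<=` [set x + u | u in U] `&` K].

Definition L0_locally_convex_on (K : set (L0 P)) : Prop :=
  forall x, K x -> L0_locally_convex_at K x.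

(* The traces on K of the L0-open sets are exactly the traces on K of the
   L1-open sets, where L1 P is viewed as a subset of L0 P through L1_L0. *)
Definition L0_L1_topologies_agree (K : set (L0 P)) : Prop :=
  K `<=` range (@L1_L0 _ _ _ P) /\
  forall A : set (L0 P),
    (exists2 U : set (L0 P), open U & A = U `&` K) <->
    (exists2 V : set (L1 P), open V & A = (@L1_L0 _ _ _ P @` V) `&` K).

End local_convexity.

(* L0 P and L0 Q are different quotient types. When P and Q have the same null
   sets, this map is the canonical identification of L0 P with L0 Q: it sends
   the P-class of a random variable to its Q-class. *)
Definition L0_transfer d (T : measurableType d) (R : realType)
    (P Q : probability T R) (f : L0 P) : L0 Q := L0_pi Q (repr f).

(* Main.v *)
Require Import Defs.
From HB Require Import structures.
From mathcomp Require Import all_boot all_order all_algebra.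
From mathcomp Require Import all_classical all_reals all_analysis.
From mathcomp Require Import measurable_realfun.
From mathcomp Require Import ring lra.

Set Implicit Arguments.
Unset Strict Implicit.
Unset Printing Implicit Defensive.

Import Order.TTheory GRing.Theory Num.Theory.
Import numFieldNormedType.Exports.

Local Open Scope classical_set_scope.
Local Open Scope ring_scope.

(* For a convex set [W] of nonnegative random variables, the bounded strictly
   concave utility [y |-> 1 - (1 + y)^-1] has an essentially unique maximising
   limit [Z], and the first-order condition at [Z] says that the single weight
   [(1 + Z)^-2] controls all of [W]: [E ((Y - Z) (1 + Z)^-2) <= 0] for [Y] in
   [W].  When [W] is a small convex neighbourhood of [x] in [K], [Z] is close to
   [x] in probability, hence [E ((Y - x) (1 + Z)^-2)] is small uniformly in [Y];
   the negative part of [Y - x] is at most [x] and causes no trouble.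

   Doing this for countably many [x] and ever smaller neighbourhoods gives
   weights [(1 + Z j)^-2], and [g = (\sum_j 2^-j (1 + Z j))^-2] is a positive
   density below a constant multiple of each of them.  It makes the identity
   L0-to-L1(g P) continuous at these points.  Continuity at an interior point of
   a segment of [K] propagates to its endpoints, so for the convex hull of a
   sequence it suffices to treat a sequence of barycenters. *)

(** * Fatou's lemma with varying bounds, and almost sure convergence from summable increments *)

Section convergence.
Context d (T : measurableType d) (R : realType) (P : probability T R).

Lemma integrable_bounded (f : T -> R) (C : R) :
  measurable_fun setT f -> (forall t, `|f t| <= C) ->
  P.-integrable setT (EFin \o f).
Proof.
move=> mf fC; apply: measurable_bounded_integrable => //.
  exact: fin_num_fun_lty.
by exists C; split; rewrite ?num_real// => r Cr t _;
  exact: le_trans (fC t) (ltW Cr).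
Qed.

Lemma limn_einf_nonneg (u : (\bar R)^nat) :
  (forall n, 0 <= u n)%E -> (0 <= limn_einf u)%E.
Proof.
move=> u0; rewrite limn_einf_lim; apply: lime_ge; first exact: is_cvg_einfs.
by apply: nearW => n; apply: le_ereal_inf_tmp => _ [m _ <-].
Qed.

Lemma limn_einf_le_cvg (u : (\bar R)^nat) (b : nat -> R) (l : R) :
  (forall n, u n <= (b n)%:E)%E -> b @ \oo --> l -> (limn_einf u <= l%:E)%E.
Proof.
move=> ub bl; have Ebl : (EFin \o b) @ \oo --> l%:E.
  by apply: cvg_EFin => //; exact: nearW.
rewrite limn_einf_lim -(cvg_lim _ Ebl)//; apply: lee_lim.
- exact: is_cvg_einfs.
- by apply/cvg_ex; exists l%:E.
- apply: nearW => n; apply: le_trans (ub n).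
  by apply: ereal_inf_lbound; exists n => /=.
Qed.

Lemma measurable_limn_einf (f : nat -> T -> \bar R) :
  (forall n, measurable_fun setT (f n)) ->
  measurable_fun setT (fun t => limn_einf (f^~ t)).
Proof.
move=> mf; rewrite (_ : (fun _ => _) =
    (fun t => (- limn_esup ((fun n t => - f n t) ^~ t))%E)); last first.
  by apply/funext => t; rewrite -limn_einfN; congr limn_einf; apply/funext => n;
    rewrite /= oppeK.
by apply: measurableT_comp => //; apply: measurable_fun_limn_esup => n;
  exact: measurableT_comp.
Qed.

(** Almost everywhere [h] is the liminf of the [f n], so Fatou's lemma applies. The bound may vary
    with [n] because the estimates along a minimising sequence become sharp only in the limit. *)
Lemma fatou_cvg (f : nat -> T -> R) (h : T -> R) (b : nat -> R) (l : R) :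
  (forall n, measurable_fun setT (f n)) -> (forall n t, 0 <= f n t) ->
  measurable_fun setT h -> (forall t, 0 <= h t) ->
  {ae P, forall t, f n t @[n --> \oo] --> h t} ->
  (forall n, (\int[P]_t (f n t)%:E <= (b n)%:E)%E) -> b @ \oo --> l ->
  (\int[P]_t (h t)%:E <= l%:E)%E.
Proof.
move=> mf f0 mh h0 fh fb bl.
have mEf n : measurable_fun setT (EFin \o f n) by exact/measurable_EFinP.
have -> : (\int[P]_t (h t)%:E = \int[P]_t limn_einf (fun n => (f n t)%:E))%E.
  apply: ge0_ae_eq_integral => //.
  - exact/measurable_EFinP.
  - exact: measurable_limn_einf.
  - by move=> t _; rewrite lee_fin.
  - by move=> t _; apply: limn_einf_nonneg => n; rewrite lee_fin.
  - move: fh; apply: filterS => t ft _.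
    have /cvg_limn_einf_sup[-> //] : (f n t)%:E @[n --> \oo] --> (h t)%:E.
    by apply: cvg_EFin => //; exact: nearW.
apply: le_trans (limn_einf_le_cvg fb bl).
apply: (@fatou _ T R P setT measurableT (fun n => EFin \o f n)) => //.
by move=> n t _; rewrite lee_fin.
Qed.

(** The series of the absolute increments has a finite integral, hence is finite almost everywhere,
    and there the telescoping series of [v] converges absolutely. *)
Lemma ae_cvg_summable (v : nat -> T -> R) (c : nat -> R) (M : R) :
  (forall n, measurable_fun setT (v n)) ->
  (forall n, (\int[P]_t (`|v n.+1 t - v n t|)%:E <= (c n)%:E)%E) ->
  (\sum_(0 <= n <oo) (c n)%:E <= M%:E)%E ->
  {ae P, forall t, cvgn (v^~ t)}.
Proof.
move=> mv vc cM.
pose D n t := `|v n.+1 t - v n t|.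
have mD n : measurable_fun setT (EFin \o D n).
  by apply/measurable_EFinP; apply: measurableT_comp => //;
    exact: measurable_funB.
have D0 n t : (0 <= (EFin \o D n) t)%E by rewrite lee_fin; exact: normr_ge0.
have : P.-integrable setT (fun t => \sum_(0 <= n <oo) (EFin \o D n) t)%E.
  apply/integrableP; split; first exact: ge0_emeasurable_sum.
  under eq_integral do rewrite gee0_abs ?nneseries_ge0//.
  rewrite integral_nneseries//; apply: le_lt_trans (ltry M).
  apply: le_trans cM; apply: lee_nneseries => [n _ _|n _]; last exact: vc.
  exact: integral_ge0.
move=> /integrable_ae => /(_ measurableT); apply: filterS => t /(_ I) Dfin.
have cD : cvgn (series (D^~ t)).
  apply: nnseries_is_cvg; first by move=> n; rewrite /D.
  by rewrite ltey_eq Dfin.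
have cv : cvgn (series (telescope (v^~ t))) by apply: normed_cvg.
have -> : v^~ t = (fun n => v 0%N t + series (telescope (v^~ t)) n).
  by apply/funext => n; rewrite -eq_sum_telescope.
by apply: is_cvgD => //; exact: is_cvg_cst.
Qed.

End convergence.

(** * Quantitative convexity of [(1 + y)^-1] *)

Section disutility.
Context (R : realType).
Implicit Types a b s : R.

(* The harmonic mean of [(1 + a)^-1] and [(1 + b)^-1] falls short of their
   arithmetic mean by at least a quarter of their squared difference, which is
   then linearised by AM-GM. *)
Lemma inv1D_midpoint a b s : 0 <= a -> 0 <= b -> 0 < s ->
  (1 + (2^-1 * a + 2^-1 * b))^-1 + s * (`|(1 + a)^-1 - (1 + b)^-1| - s) <=
  2^-1 * ((1 + a)^-1 + (1 + b)^-1).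
Proof.
move=> a0 b0 s0.
set x := (1 + a)^-1; set y := (1 + b)^-1.
have x0 : 0 < x by rewrite invr_gt0 ltr_pwDl.
have y0 : 0 < y by rewrite invr_gt0 ltr_pwDl.
have x1 : x <= 1 by rewrite invf_le1 ?lerDl// ltr_pwDl.
have y1 : y <= 1 by rewrite invf_le1 ?lerDl// ltr_pwDl.
have -> : (1 + (2^-1 * a + 2^-1 * b))^-1 = 2 * x * y / (x + y).
  rewrite /x /y; field.
  by apply/and3P; split; apply: lt0r_neq0; lra.
have d2 : s * (`|x - y| - s) <= (x - y) ^+ 2 / 4.
  rewrite -[(x - y) ^+ 2]real_normK ?num_real//.
  by have := sqr_ge0 (`|x - y| / 2 - s); rewrite !expr2; lra.
have h : 2^-1 * (x + y) = 2 * x * y / (x + y) + (x - y) ^+ 2 / (2 * (x + y)).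
  by field; rewrite lt0r_neq0// addr_gt0.
rewrite h lerD2l; apply: le_trans d2 _.
(* Both reciprocals are at most 1, whence [2 * (x + y) <= 4]. *)
by rewrite ler_wpM2l ?sqr_ge0// lef_pV2 ?posrE; lra.
Qed.

End disutility.

(** * Linear calculus of integrals of bounded measurable functions *)

Section bounded_functions.
Context d (T : measurableType d) (R : realType) (P : probability T R).
Implicit Types (f g : T -> R) (k : R).

Definition bounded_mfun f :=
  measurable_fun setT f /\ exists C, forall t, `|f t| <= C.

Lemma bounded_mfun_cst k : bounded_mfun (fun=> k).
Proof. by split; [exact: measurable_cst|exists `|k|]. Qed.

Lemma bounded_mfunD f g : bounded_mfun f -> bounded_mfun g ->
  bounded_mfun (fun t => f t + g t).
Proof.
move=> [mf [C fC]] [mg [D gD]]; split; first exact: measurable_funD.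
by exists (C + D) => t; rewrite (le_trans (ler_normD _ _))// lerD.
Qed.

Lemma bounded_mfunM f g : bounded_mfun f -> bounded_mfun g ->
  bounded_mfun (fun t => f t * g t).
Proof.
move=> [mf [C fC]] [mg [D gD]]; split; first exact: measurable_funM.
by exists (C * D) => t; rewrite normrM ler_pM.
Qed.

Lemma bounded_mfunB f g : bounded_mfun f -> bounded_mfun g ->
  bounded_mfun (fun t => f t - g t).
Proof.
move=> [mf [C fC]] [mg [D gD]]; split; first exact: measurable_funB.
by exists (C + D) => t; rewrite (le_trans (ler_normB _ _))// lerD.
Qed.

Lemma bounded_mfun_norm f : bounded_mfun f -> bounded_mfun (fun t => `|f t|).
Proof.
move=> [mf [C fC]]; split; first exact: measurableT_comp.
by exists C => t; rewrite normr_id.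
Qed.

Lemma integrable_bounded_mfun f :
  bounded_mfun f -> P.-integrable setT (EFin \o f).
Proof. by move=> [mf [C fC]]; exact: integrable_bounded fC. Qed.

Lemma EFin_Rintegral f : bounded_mfun f ->
  (\int[P]_t (f t)%:E = (\int[P]_t f t)%:E)%E.
Proof.
move=> bf; rewrite /Rintegral fineK//.
exact/integrable_fin_num/integrable_bounded_mfun.
Qed.

Lemma RintegralD_bounded f g : bounded_mfun f -> bounded_mfun g ->
  \int[P]_t (f t + g t) = \int[P]_t f t + \int[P]_t g t.
Proof. by move=> bf bg; apply: RintegralD => //;
  exact: integrable_bounded_mfun. Qed.

Lemma RintegralB_bounded f g : bounded_mfun f -> bounded_mfun g ->
  \int[P]_t (f t - g t) = \int[P]_t f t - \int[P]_t g t.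
Proof. by move=> bf bg; apply: RintegralB => //;
  exact: integrable_bounded_mfun. Qed.

Lemma RintegralZl_bounded f k : bounded_mfun f ->
  \int[P]_t (k * f t) = k * \int[P]_t f t.
Proof. by move=> bf; apply: RintegralZl => //;
  exact: integrable_bounded_mfun. Qed.

Lemma Rintegral_cst_probability k : \int[P]_(t in setT) k = k.
Proof. by rewrite Rintegral_cst// (_ : fine _ = 1) ?mulr1//;
  rewrite [X in fine X](probability_setT P). Qed.

Lemma le_Rintegral_bounded f g : bounded_mfun f -> bounded_mfun g ->
  (forall t, f t <= g t) -> \int[P]_t f t <= \int[P]_t g t.
Proof. by move=> bf bg fg; apply: le_Rintegral => // *;
  exact: integrable_bounded_mfun. Qed.

Lemma measurable_funV_ge0 f : measurable_fun setT f -> (forall t, 0 <= f t) ->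
  measurable_fun setT (fun t => (f t)^-1).
Proof.
move=> mf f0; rewrite (_ : (fun _ => _) = (fun t => f t `^ (-1))).
  exact: (measurableT_comp (measurable_powR _)).
by apply/funext => t; rewrite powR_inv1.
Qed.

Lemma bounded_mfun_inv1D f : measurable_fun setT f -> (forall t, 0 <= f t) ->
  bounded_mfun (fun t => (1 + f t)^-1).
Proof.
move=> mf f0; have f1 t : 0 < 1 + f t by rewrite ltr_pwDl.
split; first by apply: measurable_funV_ge0 => [|t];
  [exact: measurable_funD|exact: ltW].
by exists 1 => t; rewrite ger0_norm ?invr_ge0 ?(ltW (f1 t))// invf_le1// lerDl.
Qed.

End bounded_functions.

(** Let [l] be the limit of the reciprocals. If [l = 0], then [f] tends to +oo, against the finite
    liminf; otherwise [1 + f] tends to [l^-1]. *)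
Lemma cvgn_inv1D (R : realType) (f : nat -> R) : (forall n, 0 <= f n) ->
  cvgn (fun n => (1 + f n)^-1) -> (limn_einf (EFin \o f) < +oo)%E -> cvgn f.
Proof.
move=> f0 /cvg_ex[l fl] fy.
have fE : (fun n => 1 + f n) = (fun n => ((1 + f n)^-1)^-1).
  by apply/funext => n; rewrite invrK.
have [l0|l0] := eqVneq l 0.
  move: fl; rewrite l0 => /gtr0_cvgV0 => /(_ _)/wrap[].
    by apply: nearW => n; rewrite ltr_pwDl.
  move=> fy'; suff /cvg_limn_einf_sup[e _] : EFin \o f @ \oo --> +oo%E.
    by move: fy; rewrite e ltxx.
  apply/cvgeryP; apply/cvgryPge => A.
  move/cvgryPge: fy' => /(_ (1 + A)); apply: filterS => n.
  by rewrite lerD2l.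
have : (fun n => 1 + f n) @ \oo --> l^-1 by rewrite fE; exact: cvgV.
move=> h; rewrite (_ : f = (fun n => (1 + f n) - 1)).
  by apply: is_cvgB; [apply/cvg_ex; exists l^-1|exact: is_cvg_cst].
by apply/funext => n; rewrite addrC addKr.
Qed.

(** * Maximising expected utility over a convex set of nonnegative functions *)

Section minimisation.
Context d (T : measurableType d) (R : realType) (P : probability T R).
Variables (W : set (T -> R)).
Hypothesis measurable_W : forall f, W f -> measurable_fun setT f.
Hypothesis W_ge0 : forall f, W f -> forall t, 0 <= f t.
Hypothesis W_convex : forall (f g : T -> R) (s : R), W f -> W g ->
  0 <= s <= 1 -> W (fun t => (1 - s) * f t + s * g t).

(** A disutility, equal to 1 minus the utility: maximising expected utility means minimising
    [phi]. *)
Let v (f : T -> R) (t : T) : R := (1 + f t)^-1.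
Let phi f : R := \int[P]_t v f t.
Let I : R := inf [set phi f | f in W].

Let v_gt0 f t : W f -> 0 < v f t.
Proof. by move=> Wf; rewrite invr_gt0 ltr_pwDl// W_ge0. Qed.

Let v_le1 f t : W f -> v f t <= 1.
Proof. by move=> Wf; rewrite invf_le1 ?lerDl ?W_ge0// ltr_pwDl// W_ge0. Qed.

Let bounded_v f : W f -> bounded_mfun (v f).
Proof.
by move=> Wf; apply: bounded_mfun_inv1D; [exact: measurable_W|exact: W_ge0].
Qed.

Let phi_ge0 f : W f -> 0 <= phi f.
Proof. by move=> Wf; apply: Rintegral_ge0 => t _; rewrite ltW// v_gt0. Qed.

Let has_inf_phi f : W f -> has_inf [set phi f | f in W].
Proof.
move=> Wf; split; first by exists (phi f), f.
by exists 0 => _ [g Wg <-]; exact: phi_ge0.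
Qed.

Let I_le f : W f -> I <= phi f.
Proof.
by move=> Wf; apply: ge_inf; [have [] := has_inf_phi Wf|exists f].
Qed.

(** The midpoint of [f] and [g] lies in [W], so its [phi] is at least [I]. Integrating
    [inv1D_midpoint] then gives [s * (J - s) <= s ^+ 2], where [J] is the integral to be bounded. *)
Let minimizing_pair f g s : W f -> W g -> 0 < s ->
  phi f <= I + s ^+ 2 -> phi g <= I + s ^+ 2 ->
  (\int[P]_t (`|v f t - v g t|)%:E <= (2 * s)%:E)%E.
Proof.
move=> Wf Wg s0 fs gs.
have half01 : 0 <= (2^-1 : R) <= 1 by lra.
have := W_convex Wf Wg half01.
set h := (fun t => _) => Wh.
have bf := bounded_v Wf; have bg := bounded_v Wg.
have bD := bounded_mfun_norm (bounded_mfunB bf bg).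
have bs := bounded_mfun_cst T s.
have bDs := bounded_mfunM bs (bounded_mfunB bD bs).
rewrite EFin_Rintegral// lee_fin.
have : phi h + s * (\int[P]_t `|v f t - v g t| - s) <= 2^-1 * (phi f + phi g).
  rewrite -RintegralD_bounded// -RintegralZl_bounded; last exact: bounded_mfunD.
  rewrite -[X in s * (_ - X)](Rintegral_cst_probability P)
    -RintegralB_bounded//.
  rewrite -RintegralZl_bounded; last exact: bounded_mfunB.
  rewrite -RintegralD_bounded//; last exact: bounded_v.
  apply: le_Rintegral_bounded.
  - by apply: bounded_mfunD => //; exact: bounded_v.
  - by apply: bounded_mfunM; [exact: bounded_mfun_cst|exact: bounded_mfunD].
  - move=> t; rewrite /v /h (_ : 1 - 2^-1 = 2^-1 :> R); last by lra.
    by apply: inv1D_midpoint => //; exact: W_ge0.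
have := I_le Wh.
set J := Rintegral _ _ _ => Ih h1.
rewrite -(ler_pM2l s0); move: fs gs h1; rewrite !expr2 => fs gs h1; lra.
Qed.

(** An exact difference quotient of [phi] on the segment from [f] to [g]: with [h] the point reached
    and [J] the integral on the left, [phi f - phi h = s * (J - phi h)]. As
    [phi f - phi h <= s ^+ 2], [J] exceeds [phi h] by at most [s]. *)
Let first_order f g s : W f -> W g -> 0 < s < 1 -> phi f <= I + s ^+ 2 ->
  (\int[P]_t ((1 + g t) * v f t *
      v (fun t => (1 - s) * f t + s * g t)%R t)%:E <=
    ((I + s ^+ 2) / (1 - s) + s)%:E)%E.
Proof.
move=> Wf Wg /andP[s0 s1] fs.
have s01 : 0 <= s <= 1 by rewrite !ltW.
have := W_convex Wf Wg s01; set h := (fun t => _) => Wh.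
have hE t : v f t + s * v h t = v h t + s * ((1 + g t) * v f t * v h t).
  have := v_gt0 t Wf; have := v_gt0 t Wh; rewrite /v !invr_gt0.
  move=> h0 f0; rewrite /h; field; rewrite -/(h t) !lt0r_neq0//.
have bf := bounded_v Wf; have bh := bounded_v Wh.
have bg : bounded_mfun (fun t => (1 + g t) * v f t * v h t).
  split.
    apply: measurable_funM; last by case: bh.
    by apply: measurable_funM; [apply: measurable_funD => //;
      exact: measurable_W|case: bf].
  (* Although [g] may be unbounded, [s * (1 + g) <= 1 + h] bounds the integrand. *)
  exists s^-1 => t.
  rewrite ger0_norm ?mulr_ge0 ?(ltW (v_gt0 _ _)) ?addr_ge0 ?W_ge0//.
  rewrite -(ler_pM2l s0) divff ?gt_eqF//.
  have : s * ((1 + g t) * v h t) <= 1.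
    rewrite mulrA -ler_pdivlMr ?v_gt0// invrK mul1r /h.
    have := W_ge0 Wf t; rewrite mulrDr mulr1 addrA lerD2r => f0.
    by rewrite -[leLHS]addr0 lerD ?(ltW s1)// mulr_ge0// subr_ge0 ltW.
  have := v_le1 t Wf; have := ltW (v_gt0 t Wf); have := ltW (v_gt0 t Wh).
  have := W_ge0 Wg t; move: (g t) (v f t) (v h t) => a b c a0 c0 b0 b1 h1.
  rewrite (_ : s * _ = s * ((1 + a) * c) * b); last by ring.
  by rewrite mulr_ile1// !mulr_ge0 ?addr_ge0// ltW.
rewrite EFin_Rintegral// lee_fin.
set J := Rintegral _ _ _.
have eqJ : phi f + s * phi h = phi h + s * J.
  rewrite -!RintegralZl_bounded// -!RintegralD_bounded//.
  - by apply: eq_Rintegral => t _; exact: hE.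
  - by apply: bounded_mfunM => //; exact: bounded_mfun_cst.
  - by apply: bounded_mfunM => //; exact: bounded_mfun_cst.
(* Pointwise, [(1 - s) * (1 + f) <= 1 + h], because [g] is nonnegative. *)
have h_le : phi h <= (I + s ^+ 2) / (1 - s).
  rewrite ler_pdivlMr ?subr_gt0// mulrC; apply: le_trans fs.
  rewrite -RintegralZl_bounded//; apply: le_Rintegral_bounded => //.
    by apply: bounded_mfunM => //; exact: bounded_mfun_cst.
  move=> t.
  rewrite -ler_pdivlMr ?v_gt0// invrK.
  rewrite ler_pdivlMl; last by rewrite ltr_pwDl// W_ge0.
  have := W_ge0 Wf t; have := W_ge0 Wg t; rewrite /h; nra.
have := I_le Wh; move: h_le; set K := _ / _ => h_le Ih.
rewrite -(ler_pM2l s0) in h_le; rewrite -(ler_pM2l s0).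
by move: fs; rewrite expr2; lra.
Qed.

(** The error is a square because [minimizing_pair] loses a square root; consecutive terms are then
    at summable distances after applying [v]. *)
Let exists_minimizing_seq x : W x -> exists f : nat -> T -> R, forall n,
  W (f n) /\ phi (f n) <= I + ((2 ^ n.+1)%:R^-1) ^+ 2.
Proof.
move=> Wx; suff /choice[f Wf] : forall n, exists f : T -> R,
    W f /\ phi f <= I + ((2 ^ n.+1)%:R^-1) ^+ 2 by exists f.
move=> n; have e0 : 0 < ((2 ^ n.+1)%:R^-1) ^+ 2 :> R.
  by rewrite exprn_gt0// invr_gt0 ltr0n expn_gt0.
have [_ [f Wf <-] /ltW ?] := inf_adherent e0 (has_inf_phi Wx).
by exists f.
Qed.

(** [Z] is the almost sure limit of a minimising sequence; it need not belong to [W], which is not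
    assumed closed. Letting [s] tend to 0 in [first_order] bounds the left-hand integral by [I], and
    [I <= phi x]. Since [W] is close to [x] in probability, so is [Z], and replacing [v x] by the
    weighted integrand on the right costs at most [4 * e]. *)
Lemma exists_utility_maximizer (x : T -> R) (M e : R) : W x -> 0 <= e ->
  (forall f, W f -> (\int[P]_t (f t)%:E <= M%:E)%E) ->
  (forall f, W f -> (P [set t | (e <= `|f t - x t|)%R] <= e%:E)%E) ->
  exists Z : T -> R, [/\ measurable_fun setT Z, forall t, 0 <= Z t,
    (\int[P]_t (Z t)%:E <= M%:E)%E &
    forall f, W f ->
      (\int[P]_t ((1 + f t) / (1 + Z t) ^+ 2)%:E <=
       \int[P]_t ((1 + x t) / (1 + Z t) ^+ 2)%:E + (4 * e)%:E)%E].
Proof.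
move=> Wx e0 WM Wxe.
have [f Wf] := exists_minimizing_seq Wx.
have phif n := (Wf n).2; have {}Wf n : W (f n) := (Wf n).1.
pose s n : R := (2 ^ n.+1)%:R^-1.
have s0 n : 0 < s n by rewrite invr_gt0 ltr0n expn_gt0.
have sS n : s n.+1 <= s n.
  by rewrite lef_pV2 ?posrE ?ltr0n ?expn_gt0// ler_nat leq_exp2l.
have s1 n : s n < 1 by rewrite invf_lt1 ?ltr0n ?expn_gt0// ltr1n -{1}(expn0 2)
  ltn_exp2l.
have ae_v : {ae P, forall t, cvgn (fun n => v (f n) t)}.
  apply: (@ae_cvg_summable _ _ _ _ _ (fun n => 2 * s n) 2).
  - by move=> n; case: (bounded_v (Wf n)).
  - move=> n; apply: minimizing_pair => //.
    apply: le_trans (phif n.+1) _; rewrite lerD2l !expr2.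
    by apply: ler_pM; rewrite ?(ltW (s0 _)) ?sS.
  - by apply: epsilon_trick0.
have mEf n : measurable_fun setT (EFin \o f n)
  by exact/measurable_EFinP/measurable_W.
(* Convergence of [v (f n t)] alone would allow [f n t] to tend to +oo; the common bound [M]
   excludes this almost everywhere. *)
have int_liminf : (\int[P]_t limn_einf (fun n => (f n t)%:E) <= M%:E)%E.
  apply: le_trans (@fatou _ T R P setT measurableT (fun n =>
    EFin \o f n) mEf _) _.
    by move=> n t _; rewrite lee_fin W_ge0.
  apply: (@limn_einf_le_cvg _ _ (fun=> M)); last exact: cvg_cst.
  by move=> n; exact: WM.
have ae_liminf : {ae P, forall t, (limn_einf (fun n => (f n t)%:E) < +oo)%E}.
  have : P.-integrable setT (fun t => limn_einf (fun n => (f n t)%:E)).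
    apply/integrableP; split; first exact: measurable_limn_einf.
    under eq_integral => t _.
      rewrite gee0_abs; last by apply: limn_einf_nonneg => n;
        rewrite lee_fin W_ge0.
      over.
    exact: le_lt_trans (ltry M).
  move=> /integrable_ae => /(_ measurableT); apply: filterS => t /(_ Logic.I).
  by move/fin_numPlt/andP => [].
(* Taking the limsup makes [Z] measurable and nonnegative everywhere; [fine] sends +oo to 0, which
   matters only on a null set. *)
pose Z t := fine (limn_esup (fun n => (f n t)%:E)).
have fZ : {ae P, forall t, f n t @[n --> \oo] --> Z t}.
  move: ae_v ae_liminf; apply: filterS2 => t vt ft.
  have /cvg_ex[l fl] : cvgn (f^~ t).
    by apply: cvgn_inv1D => // n; exact: W_ge0.
  have /cvg_limn_einf_sup[_ e'] : (f n t)%:E @[n --> \oo] --> l%:E.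
    by apply: cvg_EFin => //; exact: nearW.
  by rewrite /Z e'.
have mZ : measurable_fun setT Z.
  by apply: measurableT_comp => //; exact: measurable_fun_limn_esup.
have Z0 t : 0 <= Z t.
  apply: fine_ge0; apply: le_trans (limn_einf_sup _);
    apply: limn_einf_nonneg => n.
  by rewrite lee_fin W_ge0.
have s_cvg0 : s @ \oo --> 0.
  rewrite (_ : s = (fun n => geometric 2^-1 2^-1 n)).
    by apply: cvg_geometric; rewrite ger0_norm; lra.
  by apply/funext => n; rewrite /s /= natrX exprVn exprS invfM.
have mV : bounded_mfun (fun t => (1 + Z t)^-1) by exact: bounded_mfun_inv1D.
have vV : {ae P, forall t, v (f n) t @[n --> \oo] --> (1 + Z t)^-1}.
  move: fZ; apply: filterS => t ft; apply: cvgV;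
    first by rewrite gt_eqF// ltr_pwDl.
  by apply: cvgD => //; exact: cvg_cst.
exists Z; split => //.
  apply: (@fatou_cvg _ _ _ _ f _ (fun=> M)) => //.
  - by move=> n; exact: measurable_W.
  - by move=> n t; exact: W_ge0.
  - by move=> n; exact: WM.
  - exact: cvg_cst.
move=> g Wg.
have W_h n : W (fun t => (1 - s n) * f n t + s n * g t).
  by apply: W_convex; rewrite ?ltW.
(* In [first_order] along [s n], both factors [v] tend to [(1 + Z)^-1] and the bound tends to
   [I]. *)
have gI : (\int[P]_t ((1 + g t) / (1 + Z t) ^+ 2)%:E <= I%:E)%E.
  apply: (@fatou_cvg _ _ _ _ (fun n t =>
    (1 + g t) * v (f n) t * v (fun t => (1 - s n) * f n t + s n * g t) t) _
    (fun n => (I + s n ^+ 2) / (1 - s n) + s n)).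
  - move=> n; apply: measurable_funM; last by case: (bounded_v (W_h n)).
    apply: measurable_funM; last by case: (bounded_v (Wf n)).
    by apply: measurable_funD => //; exact: measurable_W.
  - move=> n t; rewrite !mulr_ge0 ?(ltW (v_gt0 _ _))// ?addr_ge0// ?W_ge0//.
  - apply: measurable_funM.
      by apply: measurable_funD => //; exact: measurable_W.
    rewrite (_ : (fun _ => _) = (fun t => (1 + Z t)^-1 ^+ 2)).
    by apply: measurable_funX; case: mV.
  by apply/funext => t; rewrite exprVn.
  - by move=> t; apply: divr_ge0; rewrite ?exprn_ge0// addr_ge0// W_ge0.
  - move: fZ vV; apply: filterS2 => t ft vt.
    rewrite expr2 invfM mulrA; apply: cvgM.
      by apply: cvgM => //; exact: cvg_cst.
    apply: cvgV; first by rewrite gt_eqF// ltr_pwDl.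
    rewrite (_ : 1 + Z t = 1 + ((1 - 0) * Z t + 0 * g t)); last by ring.
    apply: cvgD; first exact: cvg_cst.
    apply: cvgD; apply: cvgM => //; last exact: cvg_cst.
    by apply: cvgB => //; exact: cvg_cst.
  - by move=> n; apply: first_order => //; rewrite s0 s1.
  - rewrite [X in _ --> X](_ : I = (I + 0 * 0) / (1 - 0) + 0); last first.
      by rewrite mulr0 !addr0 subr0 divr1.
    apply: cvgD => //; apply: cvgM.
      apply: cvgD; first exact: cvg_cst.
      by under eq_fun do rewrite expr2; exact: cvgM.
    apply: cvgV; first by rewrite subr0 oner_neq0.
    by apply: cvgB => //; exact: cvg_cst.
apply: le_trans gI _.
(* [v] is 1-Lipschitz with values in [0, 1]: [v (f n)] is within [e] of [v x] off an event of
   probability at most [e], and within 1 on it. The bound survives the limit in [n]. *)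
have xV : (\int[P]_t (`|v x t - (1 + Z t)^-1|)%:E <= (2 * e)%:E)%E.
  apply: (@fatou_cvg _ _ _ _ (fun n t => `|v x t - v (f n) t|) _ (fun=> 2 * e)).
  - move=> n;
    case: (bounded_mfun_norm (bounded_mfunB (bounded_v Wx)
      (bounded_v (Wf n)))) => //.
  - by [].
  - by case: (bounded_mfun_norm (bounded_mfunB (bounded_v Wx) mV)).
  - by [].
  - move: vV; apply: filterS => t vt; apply: cvg_norm.
    by apply: cvgB => //; exact: cvg_cst.
  - move=> n; pose A := [set t | e <= `|f n t - x t|].
    have mA : measurable A.
      rewrite -[A]setTI; apply: (measurable_fun_le _ _) => //.
      apply: measurableT_comp => //; apply: measurable_funB => //;
        exact: measurable_W.
    apply: (@le_trans _ _ (\int[P]_t (e%:E + (\1_A t)%:E))%E).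
      apply: ge0_le_integral => //.
      - case: (bounded_mfun_norm (bounded_mfunB (bounded_v Wx)
        (bounded_v (Wf n)))) => + _.
        by move=> ?; apply/measurable_EFinP.
      - by apply: emeasurable_funD => //; apply/measurable_EFinP.
      - move=> t _; rewrite -EFinD lee_fin indicE.
        have := W_ge0 Wx t; have := W_ge0 (Wf n) t => f0 x0.
        have vE : v x t - v (f n) t = (f n t - x t) * (v x t * v (f n) t).
          by rewrite /v; field; rewrite !gt_eqF// ltr_pwDl.
        have [tA|/negP] := boolP (t \in A).
          have := v_le1 t Wx; have := v_le1 t (Wf n).
          have := v_gt0 t Wx; have := v_gt0 t (Wf n).
          by rewrite mulr1n ler_norml; lra.
        rewrite inE /A /= => /negP; rewrite -ltNge => fxe.
        rewrite addr0 vE normrM [X in _ * X]ger0_norm; last first.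
          by rewrite mulr_ge0// ltW// v_gt0.
        apply: le_trans (ltW fxe); rewrite ler_piMr//.
        by rewrite mulr_ile1// ?v_le1// ltW// v_gt0.
    rewrite ge0_integralD//; first last.
      by apply/measurable_EFinP.
    rewrite integral_cst// integral_indic// setIT.
    have -> : (2 * e)%:E = (e%:E * 1 + e%:E)%E.
      by rewrite mule1 -EFinD -mulr2n mulr_natl.
    apply: leeD; last exact: Wxe.
    by rewrite lee_wpmul2l ?lee_fin//; exact: probability_le1.
  - exact: cvg_cst.
have : (I%:E <= (phi x)%:E)%E by rewrite lee_fin I_le.
move/le_trans; apply.
rewrite -EFin_Rintegral; last exact: bounded_v.
have mxZ : measurable_fun setT (fun t => (1 + x t) / (1 + Z t) ^+ 2).
  apply: measurable_funM.
    by apply: measurable_funD => //; exact: measurable_W.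
  rewrite (_ : (fun _ => _) = (fun t => (1 + Z t)^-1 ^+ 2)).
    by apply: measurable_funX; case: mV.
  by apply/funext => t; rewrite exprVn.
have [mD _] := bounded_mfun_norm (bounded_mfunB (bounded_v Wx) mV).
have xZ0 t : 0 <= (1 + x t) / (1 + Z t) ^+ 2.
  by apply: divr_ge0; rewrite ?exprn_ge0// addr_ge0// W_ge0.
(* With [a = v x] and [b = (1 + Z)^-1], the pointwise claim is [a <= b ^+ 2 / a + 2 * |a - b|], that
   is, [a ^+ 2 - b ^+ 2 <= 2 * a * |a - b|]. *)
apply: (@le_trans _ _ (\int[P]_t (((1 + x t) / (1 + Z t) ^+ 2)%:E +
    2%:E * (`|v x t - (1 + Z t)^-1|)%:E))%E).
  apply: ge0_le_integral => //.
  - by move=> t _; rewrite lee_fin ltW// v_gt0.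
  - by apply/measurable_EFinP; case: (bounded_v Wx).
  - apply: emeasurable_funD; first exact/measurable_EFinP.
    by apply: emeasurable_funM => //; exact/measurable_EFinP.
  - move=> t _; rewrite -EFinM -EFinD lee_fin.
    rewrite -exprVn; have : 0 < (1 + Z t)^-1 by rewrite invr_gt0 ltr_pwDl.
    have : 1 + x t = (v x t)^-1 by rewrite invrK.
    move=> ->; have := v_gt0 t Wx; move: (v x t) (_^-1) => a b a0 b0.
    rewrite -(ler_pM2l a0) (_ : a * (_ + _) = b ^+ 2 + 2 * a * `|a - b|);
      last first.
      by field; rewrite gt_eqF.
    by have [ab|ab] := lerP b a; nra.
rewrite ge0_integralD//; first last.
  - by apply: emeasurable_funM => //; exact/measurable_EFinP.
  - exact/measurable_EFinP.
  - by move=> t _; rewrite lee_fin.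
apply: leeD => //; rewrite ge0_integralZl//; last exact/measurable_EFinP.
have -> : (4 * e)%:E = (2%:E * (2 * e)%:E)%E by rewrite -EFinM mulrA -natrM.
by rewrite lee_wpmul2l// lee_fin.
Qed.

End minimisation.

(** * Absolute continuity in epsilon-delta form *)

Section absolute_continuity.
Context d (T : measurableType d) (R : realType) (P Q : probability T R).

(** The Radon-Nikodym derivative of [Q] is [P]-integrable, so its integral over a set is small when
    the set has small [P]-measure. This compares the balls of [L0 P] and [L0 Q] later on. *)
Lemma null_dominates_eps_delta (e : R) : Q `<< P -> 0 < e ->
  exists2 r : R, 0 < r &
    forall A, measurable A -> (P A < r%:E)%E -> (Q A < e%:E)%E.
Proof.
move=> QP e0; pose f t := fine (Radon_Nikodym_SigmaFinite.f Q P t).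
have fE : EFin \o f = Radon_Nikodym_SigmaFinite.f Q P.
  apply/funext => t; rewrite /f /= fineK//.
  exact: Radon_Nikodym_SigmaFinite.f_fin_num.
have f0 t : 0 <= f t by apply/fine_ge0/Radon_Nikodym_SigmaFinite.f_ge0.
have intf : P.-integrable setT (EFin \o f).
  by rewrite fE; exact: Radon_Nikodym_SigmaFinite.f_integrable.
have [r [r0 rf]] := integral_normr_continuous intf e0.
exists r => // A mA /(rf _ mA).
have -> : \int[P]_(x in A) `|f x| = fine (Q A).
  rewrite (Radon_Nikodym_SigmaFinite.f_integral QP)// -fE; congr fine.
  by apply: eq_integral => t _; rewrite /= ger0_norm.
by rewrite -lte_fin fineK ?fin_num_measure.
Qed.

End absolute_continuity.

(** * A common density for countably many weights, and the probability it defines *)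

Section density.
Context d (T : measurableType d) (R : realType) (P : probability T R).

(* [Z j] may be unbounded in [j], but [2^-j (1 + Z j)] is almost surely
   summable; the density is the squared inverse of the sum (and [0], as
   [fine +oo = 0], where the sum diverges). *)
Lemma exists_common_density (Z : nat -> T -> R) (M : R) :
  (forall j, measurable_fun setT (Z j)) -> (forall j t, 0 <= Z j t) ->
  (forall j, (\int[P]_t (Z j t)%:E <= M%:E)%E) ->
  exists g : T -> R, [/\ measurable_fun setT g, forall t, 0 <= g t,
    {ae P, forall t, 0 < g t} &
    forall j t, g t <= 4 ^+ j / (1 + Z j t) ^+ 2].
Proof.
move=> mZ Z0 ZM.
have M0 : 0 <= M.
  by rewrite -lee_fin; apply: le_trans (ZM 0%N); apply: integral_ge0 => t _;
    rewrite lee_fin.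
(* This is [2^-j (1 + Z j)], written with [2 ^ j.+1] to match the series in [epsilon_trick0]. *)
pose u j t : R := 2 * ((1 + Z j t) / (2 ^ j.+1)%:R).
have u0 j t : 0 < u j t by rewrite !mulr_gt0// ?invr_gt0 ?ltr0n ?expn_gt0//
  ltr_pwDl.
have mu j : measurable_fun setT (u j).
  apply: measurable_funM => //; apply: measurable_funM => //.
  by apply: measurable_funD.
pose S t := (\sum_(0 <= j <oo) (u j t)%:E)%E.
have mS : measurable_fun setT S.
  apply: ge0_emeasurable_sum => [j t _ _|j _]; first by rewrite lee_fin ltW.
  exact/measurable_EFinP.
have uS j t : ((u j t)%:E <= S t)%E.
  rewrite /S (nneseries_split 0 j.+1)//; last by move=> *; rewrite lee_fin ltW.
  rewrite add0n big_nat_recr//=.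
  rewrite -[leLHS]adde0; apply: leeD; last first.
    by apply: nneseries_ge0 => *; rewrite lee_fin ltW.
  by rewrite -[leLHS]add0e leeD// sume_ge0// => *; rewrite lee_fin ltW.
have S_fin : {ae P, forall t, S t \is a fin_num}.
  have : P.-integrable setT S.
    apply/integrableP; split => //.
    under eq_integral => t _.
      rewrite gee0_abs; last by apply: nneseries_ge0 => *; rewrite lee_fin ltW.
      over.
    rewrite integral_nneseries//; first last.
      by move=> j t _; rewrite lee_fin ltW.
      by move=> j; exact/measurable_EFinP.
    apply: le_lt_trans (ltry (2 * (1 + M))).
    have M1 : 0 <= 2 * (1 + M) by rewrite mulr_ge0// addr_ge0.
    apply: le_trans (epsilon_trick0 xpredT M1).
    apply: lee_nneseries => [j _ _|j _].
      by apply: integral_ge0 => t _; rewrite lee_fin ltW.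
    have p0 : 0 < (2 ^ j.+1)%:R^-1 :> R by rewrite invr_gt0 ltr0n expn_gt0.
    rewrite (_ : (fun _ => _) = (fun t =>
      (2 * (2 ^ j.+1)%:R^-1)%:E * (1%:E + (Z j t)%:E))%E).
      rewrite ge0_integralZl//; first last.
      - by move=> t _; rewrite -EFinD lee_fin addr_ge0.
      - by apply: emeasurable_funD => //; exact/measurable_EFinP.
      rewrite ge0_integralD//; first last.
      - exact/measurable_EFinP.
      - by move=> t _; rewrite lee_fin.
      rewrite integral_cst// [X in (1 * X)%E](probability_setT P)
        mule1 mulrAC [leRHS]EFinM.
      rewrite lee_wpmul2l ?lee_fin ?mulr_ge0 ?(ltW p0)// EFinD.
      by apply: leeD.
    by apply/funext => t; rewrite /u -EFinD -EFinM; congr EFin; ring.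
  by move=> /integrable_ae => /(_ measurableT); apply: filterS => t; exact.
exists (fun t => ((fine (S t))^-1) ^+ 2); split.
- apply: measurable_funX; apply: measurable_funV_ge0.
    exact: measurableT_comp.
  by move=> t; apply: fine_ge0; apply: nneseries_ge0 => *; rewrite lee_fin ltW.
- by move=> t; rewrite sqr_ge0.
- move: S_fin; apply: filterS => t St;
  rewrite exprn_gt0// invr_gt0 -lte_fin fineK//.
  by apply: lt_le_trans (uS 0%N t); rewrite lte_fin.
- move=> j t.
  have -> : 4 ^+ j / (1 + Z j t) ^+ 2 = ((u j t)^-1) ^+ 2.
    rewrite /u natrX [2 ^+ j.+1]exprS (_ : 4 = 2 ^+ 2 :> R);
      last by rewrite -natrX.
    rewrite -exprM mulnC exprM.
    have : 2 ^+ j != 0 :> R by rewrite expf_neq0.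
    have : 1 + Z j t != 0 by rewrite gt_eqF// ltr_pwDl.
    by move: (1 + Z j t) (2 ^+ j) => a b a0 b0; field; rewrite a0 b0.
  have [St|] := boolP (S t \is a fin_num).
    rewrite ler_sqr ?nnegrE ?invr_ge0// ?(ltW (u0 _ _))//; last first.
      by rewrite -lee_fin fineK// (le_trans _ (uS 0%N t))// lee_fin ltW.
    rewrite lef_pV2 ?posrE//; last first.
      by rewrite -lte_fin fineK// (lt_le_trans _ (uS 0%N t))// lte_fin.
    by rewrite -lee_fin fineK.
  have := uS 0%N t; case: (S t) => //= _ _.
  by rewrite invr0 expr0n/= sqr_ge0.
Qed.

Section density_measure.
Variable g : T -> R.
Hypothesis measurable_g : measurable_fun setT g.
Hypothesis g_ge0 : forall t, 0 <= g t.

Definition density_measure (A : set T) : \bar R :=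
  (\int[P]_(t in A) (g t)%:E)%E.

Let density_measure0 : density_measure set0 = 0%E.
Proof. exact: integral_set0. Qed.

Let density_measure_ge0 A : (0 <= density_measure A)%E.
Proof. by apply: integral_ge0 => t _; rewrite lee_fin. Qed.

Let density_measure_sigma_additive : semi_sigma_additive density_measure.
Proof.
apply: semi_sigma_additive_nng_induced => [|t]; first exact/measurable_EFinP.
by rewrite lee_fin.
Qed.

HB.instance Definition _ := isMeasure.Build _ _ _ density_measure
  density_measure0 density_measure_ge0 density_measure_sigma_additive.

(** [Q] is the normalised measure of density [g], and [c] the inverse of its total mass. The bound
    [C] makes this mass finite; almost sure positivity of [g] makes it nonzero and yields [P]
    absolutely continuous with respect to [Q]. *)
Lemma exists_density_probability (C : R) : (forall t, g t <= C) ->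
  {ae P, forall t, 0 < g t} ->
  exists Q : probability T R, [/\ Q `<< P, P `<< Q & exists2 c : R, 0 < c &
    forall h : T -> R, measurable_fun setT h -> (forall t, 0 <= h t) ->
      (\int[Q]_t (h t)%:E = c%:E * \int[P]_t (g t * h t)%:E)%E].
Proof.
move=> gC gpos.
have mg D : measurable_fun D (fun t => (g t)%:E).
  by apply/measurable_EFinP; exact: measurable_funTS.
have mu_null A : measurable A -> density_measure A = 0%E -> P A = 0%E.
  move=> mA; rewrite /density_measure => gA.
  have /ae_eq_integral_abs : (\int[P]_(t in A) `|(g t)%:E| = 0)%E.
    by rewrite -[RHS]gA; apply: eq_integral => t _; rewrite /= ger0_norm.
  move=> /(_ mA (mg A)) gA0.
  suff /negligibleP : P.-negligible A by apply.
  apply: (@negligibleS _ _ _ _ (~` [set t | ~ A t])); first by move=> t At /=;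
    apply.
  move: gpos gA0; apply: filterS2 => t g0 gt0 At.
  by case: (gt0 At) => e; move: g0; rewrite e ltxx.
have intg : P.-integrable setT (fun t => (g t)%:E).
  by apply: (@integrable_bounded _ _ _ _ _ C) => // t; rewrite ger0_norm.
have muTfin : density_measure setT \is a fin_num.
  exact: integrable_fin_num.
have muT0 : density_measure setT != 0%E.
  apply/negP => /eqP /mu_null => /(_ measurableT).
  by move/eqP; rewrite [X in X == _](probability_setT P) onee_eq0.
pose c := (fine (density_measure setT))^-1.
have c0 : 0 < c.
  by rewrite invr_gt0 fine_gt0// lt0e muT0 density_measure_ge0/= -ge0_fin_numE.
have [Q QE] : exists Q : probability T R,
    forall A, Q A = (\int[P]_(t in A) (g t)%:E * c%:E)%E.
  (* [mnormalize] falls back to [P] when the mass is 0 or +oo; both cases are ruled out. *)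
  exists (mnormalize density_measure P) => A.
  rewrite /= /mnormalize /= (negbTE muT0) /=.
  by move: muTfin; rewrite fin_numE => /andP[_ /negbTE ->].
have QP : Q `<< P.
  apply/null_content_dominatesP => A mA PA; apply: etrans (QE A) _.
  by rewrite null_set_integral ?mul0e.
have PQ : P `<< Q.
  apply/null_content_dominatesP => A mA QA.
  move: (esym (QE A)); rewrite [RHS]QA => /eqP.
  rewrite mule_eq0 => /orP[/eqP/mu_null|]; first exact.
  by rewrite eqe gt_eqF.
exists Q; split => //; exists c => // h mh h0.
rewrite -(Radon_Nikodym_SigmaFinite.change_of_variables QP)//; last first.
- exact/measurable_EFinP.
have intf := Radon_Nikodym_SigmaFinite.f_integrable QP.
have mcg : measurable_fun setT (fun t => (g t)%:E * c%:E)%E.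
  by apply: emeasurable_funM.
(* The change of variables is phrased with the Radon-Nikodym derivative, which agrees almost
   everywhere with [g * c] because both have the same integral over every measurable set. *)
have fg : ae_eq P setT (Radon_Nikodym_SigmaFinite.f Q P)
    (fun t => (g t)%:E * c%:E)%E.
  apply: integral_ae_eq => // A _ mA.
  rewrite -Radon_Nikodym_SigmaFinite.f_integral// ge0_integralZr//.
  - exact: QE.
  - by move=> t _; rewrite lee_fin.
  - by rewrite lee_fin ltW.
have mhE : measurable_fun setT (fun t => (h t)%:E) by exact/measurable_EFinP.
transitivity (\int[P]_t ((h t)%:E * ((g t)%:E * c%:E)))%E.
  apply: ae_eq_integral => //.
  - by apply: emeasurable_funM => //; exact: measurable_int intf.
  - exact: emeasurable_funM.
  - exact: ae_eqe_mul2l.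
rewrite -ge0_integralZl//.
- by apply: eq_integral => t _; rewrite -!EFinM; congr EFin; ring.
- by apply/measurable_EFinP; exact: measurable_funM.
- by move=> t _; rewrite lee_fin mulr_ge0.
- by rewrite lee_fin ltW.
Qed.

End density_measure.

End density.

(** * From a one-sided weighted estimate to a weighted distance *)

Section one_sided_bounds.
Context d (T : measurableType d) (R : realType) (P : probability T R).
Implicit Types (f x g Z : T -> R).

(** As [f] is nonnegative, the positive part of [x - f] is at most [x], whatever [f] is. Its
    integral over the event where [f] is far from [x] is therefore small by absolute continuity of
    the integral of [x]; elsewhere the integrand is at most [e / 2]. *)
Lemma integral_neg_part_small x (e : R) : measurable_fun setT x ->
  (forall t, 0 <= x t) -> (\int[P]_t (x t)%:E < +oo)%E -> 0 < e ->
  exists2 r : R, 0 < r & forall f, measurable_fun setT f ->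
    (forall t, 0 <= f t) -> (P [set t | (r <= `|f t - x t|)%R] < r%:E)%E ->
    (\int[P]_t (Num.max (x t - f t) 0)%:E <= e%:E)%E.
Proof.
move=> mx x0 xfin e0.
have intx : P.-integrable setT (EFin \o x).
  apply/integrableP; split; first exact/measurable_EFinP.
  by under eq_integral do rewrite gee0_abs ?lee_fin//.
have e20 : 0 < e / 2 by rewrite divr_gt0.
have [r [r0 rx]] := integral_normr_continuous intx e20.
exists (Num.min r (e / 2)); first by rewrite lt_min r0.
move=> f mf f0; set s := Num.min _ _ => Ps.
set A := [set t | _] in Ps.
have mA : measurable A.
  rewrite -[A]setTI; apply: (measurable_fun_le _ _) => //.
  by apply: measurableT_comp => //; exact: measurable_funB.
have s_e : s <= e / 2 by rewrite ge_min lexx orbT.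
have s_r : s <= r by rewrite ge_min lexx.
have s0 : 0 <= s by rewrite le_min !ltW.
have mxA : measurable_fun setT (fun t => (x t * \1_A t)%:E).
  by apply/measurable_EFinP; exact: measurable_funM.
apply: (@le_trans _ _ (\int[P]_t ((e / 2)%:E + (x t * \1_A t)%:E))%E).
  apply: ge0_le_integral => //.
  - by move=> t _; rewrite lee_fin le_max lexx orbT.
  - by apply/measurable_EFinP; apply: measurable_maxr => //;
    exact: measurable_funB.
  - exact: emeasurable_funD.
  - move=> t _; rewrite -EFinD lee_fin indicE.
    have := f0 t; have := x0 t; have [tA|/negP] := boolP (t \in A).
      by rewrite mulr1n ge_max => ? ?; apply/andP; split; lra.
    rewrite inE /A /= => /negP; rewrite -ltNge ltr_norml mulr0n.
    by move=> /andP[? ?] ? ?; rewrite ge_max; apply/andP; split; lra.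
rewrite ge0_integralD//; first last.
- by move=> t _; rewrite lee_fin mulr_ge0.
- by move=> t _; rewrite lee_fin ltW.
rewrite integral_cst// [X in (_ * X)%E](probability_setT P) mule1.
have -> : e%:E = ((e / 2)%:E + (e / 2)%:E)%E by rewrite -EFinD -splitr.
apply: leeD => //.
have {rx} := rx _ mA (lt_le_trans Ps _); rewrite lee_fin => /(_ s_r) /ltW.
rewrite -lee_fin; apply: le_trans.
rewrite /Rintegral fineK; last first.
  apply: integrable_fin_num => //; apply: integrable_norm.
  exact: integrableS intx.
rewrite [leRHS]integral_mkcond; apply: ge0_le_integral => //.
- by move=> t _; rewrite lee_fin mulr_ge0.
- apply/(measurable_restrictT _ mA); apply: measurable_funTS.
  by apply/measurable_EFinP; exact: measurableT_comp.
- move=> t _; rewrite patchE indicE; case: ifP => _; last by rewrite mulr0.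
  by rewrite mulr1 lee_fin ler_norm.
Qed.

(** Let [p] and [q] be the positive and negative parts of [f - x], and [V] the weight [(1 + Z)^-2].
    The weighted hypothesis bounds the integral of [(p - q) * V] by [e], and that of [q] is at most
    [r], so [p * V] integrates to at most [e + r]. It remains to use [g <= C * V] against [p] and
    [g <= 1] against [q]. *)
Lemma integral_dist_le f x g Z (C e r : R) :
  measurable_fun setT f -> (forall t, 0 <= f t) ->
  measurable_fun setT x -> (forall t, 0 <= x t) ->
  measurable_fun setT g -> (forall t, 0 <= g t <= 1) ->
  measurable_fun setT Z -> (forall t, 0 <= Z t) ->
  0 <= C -> (forall t, g t <= C / (1 + Z t) ^+ 2) ->
  (\int[P]_t (x t)%:E < +oo)%E ->
  (\int[P]_t ((1 + f t) / (1 + Z t) ^+ 2)%:E <=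
    \int[P]_t ((1 + x t) / (1 + Z t) ^+ 2)%:E + e%:E)%E ->
  (\int[P]_t (Num.max (x t - f t) 0)%:E <= r%:E)%E ->
  (\int[P]_t (g t * `|f t - x t|)%:E <= (C * (e + r) + r)%:E)%E.
Proof.
move=> mf f0 mx x0 mg g01 mZ Z0 C0 gZ xfin fxe xfr.
pose V t := (1 + Z t)^-1 ^+ 2.
have mV : measurable_fun setT V.
  by apply: measurable_funX; case: (bounded_mfun_inv1D mZ Z0).
have V0 t : 0 <= V t by rewrite sqr_ge0.
have V1 t : V t <= 1.
  by rewrite expr_le1// ?invr_ge0 ?addr_ge0// invf_le1 ?lerDl// ltr_pwDl.
have fV t : (1 + f t) / (1 + Z t) ^+ 2 = (1 + f t) * V t by rewrite /V exprVn.
have xV t : (1 + x t) / (1 + Z t) ^+ 2 = (1 + x t) * V t by rewrite /V exprVn.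
have {}fxe : (\int[P]_t ((1 + f t) * V t)%:E <=
    \int[P]_t ((1 + x t) * V t)%:E + e%:E)%E.
  move: fxe; rewrite (eq_integral (fun t => ((1 + f t) * V t)%:E)) => [|t _];
    last by rewrite fV.
  by rewrite [X in (_ <= X + _)%E](eq_integral (fun t =>
    ((1 + x t) * V t)%:E)) => // t _; rewrite xV.
pose p t := Num.max (f t - x t) 0; pose q t := Num.max (x t - f t) 0.
have p0 t : 0 <= p t by rewrite le_max lexx orbT.
have q0 t : 0 <= q t by rewrite le_max lexx orbT.
have mp : measurable_fun setT p by apply: measurable_maxr => //;
  exact: measurable_funB.
have mq : measurable_fun setT q by apply: measurable_maxr => //;
  exact: measurable_funB.
(* The identity [f - x = p - q] is put in additive form, so that it integrates with nonnegative
   integrands only. *)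
have pqE t : 1 + f t + q t = 1 + x t + p t.
  by rewrite /p /q; case: (lerP (f t - x t) 0); case: (lerP (x t - f t) 0); lra.
have normE t : `|f t - x t| = p t + q t.
  rewrite /p /q; case: (lerP (f t) (x t)); case: (lerP (f t - x t) 0);
    by case: (lerP (x t - f t) 0); lra.
have mfV : measurable_fun setT (fun t => (1 + f t) * V t).
  by apply: measurable_funM => //; exact: measurable_funD.
have mxV : measurable_fun setT (fun t => (1 + x t) * V t).
  by apply: measurable_funM => //; exact: measurable_funD.
have mpV : measurable_fun setT (fun t => p t * V t) by exact: measurable_funM.
have mqV : measurable_fun setT (fun t => q t * V t) by exact: measurable_funM.
have xV_fin : (\int[P]_t ((1 + x t) * V t)%:E)%E \is a fin_num.
  rewrite ge0_fin_numE; last by apply: integral_ge0 => t _;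
    rewrite lee_fin mulr_ge0// addr_ge0.
  apply: (@le_lt_trans _ _ (\int[P]_t (1%:E + (x t)%:E))%E).
    apply: ge0_le_integral => //.
    - by move=> t _; rewrite lee_fin mulr_ge0// addr_ge0.
    - exact/measurable_EFinP.
    - by apply: emeasurable_funD => //; exact/measurable_EFinP.
    - by move=> t _; rewrite -EFinD lee_fin ler_piMr// addr_ge0.
  rewrite ge0_integralD//; first last.
  - exact/measurable_EFinP.
  - by move=> t _; rewrite lee_fin.
  by rewrite integral_cst// [X in (_ * X)%E](probability_setT P)
    mule1 lte_add_pinfty// ltry.
have qVr : (\int[P]_t (q t * V t)%:E <= r%:E)%E.
  apply: le_trans xfr; apply: ge0_le_integral => //.
  - by move=> t _; rewrite lee_fin mulr_ge0.
  - exact/measurable_EFinP.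
  - exact/measurable_EFinP.
  - by move=> t _; rewrite lee_fin ler_piMr.
have pVer : (\int[P]_t (p t * V t)%:E <= (e + r)%:E)%E.
  rewrite -(leeD2lE _ _ xV_fin).
  have -> : (\int[P]_t ((1 + x t) * V t)%:E + \int[P]_t (p t * V t)%:E =
      \int[P]_t ((1 + f t) * V t)%:E + \int[P]_t (q t * V t)%:E)%E.
    rewrite -!ge0_integralD//.
    - apply: eq_integral => t _; rewrite -!EFinD -!mulrDl; congr (_ * _)%:E.
      by rewrite pqE.
    - by move=> t _; rewrite lee_fin mulr_ge0// addr_ge0.
    - exact/measurable_EFinP.
    - by move=> t _; rewrite lee_fin mulr_ge0.
    - exact/measurable_EFinP.
    - by move=> t _; rewrite lee_fin mulr_ge0// addr_ge0.
    - exact/measurable_EFinP.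
    - by move=> t _; rewrite lee_fin mulr_ge0.
    - exact/measurable_EFinP.
  by rewrite EFinD [leRHS]addeA; apply: leeD.
apply: (@le_trans _ _ (\int[P]_t (C%:E * (p t * V t)%:E + (q t)%:E))%E).
  apply: ge0_le_integral => //.
  - by move=> t _; rewrite lee_fin mulr_ge0//; case/andP: (g01 t).
  - apply/measurable_EFinP; apply: measurable_funM => //.
    by apply: measurableT_comp => //; exact: measurable_funB.
  - apply: emeasurable_funD; last exact/measurable_EFinP.
    by apply: emeasurable_funM => //; exact/measurable_EFinP.
  - move=> t _; rewrite -EFinM -EFinD lee_fin normE mulrDr lerD//.
      rewrite [leRHS]mulrCA mulrC ler_wpM2l//.
      by have := gZ t; rewrite -exprVn.
    by rewrite ler_piMl//; case/andP: (g01 t).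
rewrite ge0_integralD//; first last.
- exact/measurable_EFinP.
- by move=> t _; rewrite lee_fin.
- by apply: emeasurable_funM => //; exact/measurable_EFinP.
- by move=> t _; rewrite -EFinM lee_fin mulr_ge0// mulr_ge0.
rewrite EFinD EFinM; apply: leeD => //.
rewrite ge0_integralZl//; first last.
- by move=> t _; rewrite lee_fin mulr_ge0.
- exact/measurable_EFinP.
by rewrite lee_wpmul2l ?lee_fin.
Qed.

End one_sided_bounds.

(** * Convex hull of a sequence and its barycenters *)

Section convex_hulls.
Context (R : realType) (M : lmodType R).
Implicit Types (A : set M) (x y z : M) (s : R).

Lemma convex_setP A : convex_set A <-> forall x y s,
  A x -> A y -> 0 <= s <= 1 -> A (s *: x + (1 - s) *: y).
Proof.
split=> [cA x y s Ax Ay /andP[s0 s1]|cA x y s /set_mem Ax /set_mem Ay].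
  exact/set_mem/(cA x y (Itv01 s0 s1) (mem_set Ax) (mem_set Ay)).
by apply/mem_set/cA => //; apply/andP; split.
Qed.

Lemma convex_hull_convex A : convex_set (convex_hull A).
Proof.
apply/convex_setP => x y s hx hy s01 B [cB AB].
by move/convex_setP: (cB); apply => //; [exact: hx|exact: hy].
Qed.

(* [B m] is a barycenter with positive weights on all of [X 0], ..., [X m]. *)
Lemma convex_hull_barycenter (X : nat -> M) (K := convex_hull (range X)) :
  exists B : nat -> M, (forall m, K (B m)) /\
    forall y, K y -> exists m s z,
      [/\ 0 < s <= 1, K z & B m = s *: y + (1 - s) *: z].
Proof.
have /convex_setP cK : convex_set K by exact: convex_hull_convex.
have KX n : K (X n) by move=> A [_]; apply; exists n.
pose B := fix B m :=
  if m is n.+1 then 2^-1 *: B n + (1 - 2^-1) *: X m else X 0%N.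
have h01 : 0 <= (2^-1 : R) <= 1 by lra.
have KB m : K (B m) by elim: m => [|m IH] /=; [exact: KX|exact: cK].
exists B; split => //.
pose inner m s y := exists2 z, K z & B m = s *: y + (1 - s) *: z.
(* The weight of [y] can be lowered by moving the surplus into [z]; the coefficients divide by
   [1 - s'], so [s' = 1] is treated apart. *)
have inner_le m s s' y : K y -> 0 < s' <= s -> s <= 1 -> inner m s y ->
  inner m s' y.
  move=> Ky /andP[s'0 s's] s1 [z Kz Bz].
  have [s'1|s'1] := eqVneq s' 1.
    have e : s = s' by lra.
    by rewrite -e; exists z.
  have d0 : 0 < 1 - s' by rewrite subr_gt0 lt_neqAle s'1 (le_trans s's).
  exists (((s - s') / (1 - s')) *: y + (1 - (s - s') / (1 - s')) *: z).
    apply: cK => //; apply/andP; split.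
      by apply: divr_ge0; rewrite subr_ge0// (le_trans s's).
    by rewrite ler_pdivrMr// mul1r lerD2r.
  rewrite Bz scalerDr !scalerA addrA -scalerDl; congr (_ *: _ + _ *: _).
    by field; rewrite gt_eqF.
  by field; rewrite gt_eqF.
(* Passing from [B m] to [B m.+1] halves the weight of [y], and [X m.+1] is absorbed into the other
   endpoint. *)
have innerS m s y : 0 < s <= 1 -> inner m s y -> inner m.+1 (2^-1 * s) y.
  move=> /andP[s0 s1] [z Kz Bz].
  have d0 : 0 < 1 - 2^-1 * s by lra.
  pose u := (2^-1 * (1 - s)) / (1 - 2^-1 * s).
  exists (u *: z + (1 - u) *: X m.+1).
    apply: cK => //; apply/andP; split.
      by apply: divr_ge0; [rewrite mulr_ge0// subr_ge0|exact: ltW].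
    by rewrite /u ler_pdivrMr// mul1r; lra.
  rewrite [B m.+1]/= Bz !scalerDr !scalerA addrA; congr (_ + _ *: _ + _ *: _).
    by rewrite /u; field; apply: lt0r_neq0; lra.
  by rewrite /u; field; apply: lt0r_neq0; lra.
have inner_mono m n y s : (m <= n)%N -> 0 < s <= 1 -> inner m s y ->
    exists2 s', 0 < s' <= 1 & inner n s' y.
  move=> mn s01 h; elim: n mn => [|n IH].
    by rewrite leqn0 => /eqP <-; exists s.
  rewrite leq_eqVlt => /predU1P[<-|/IH[s' s'01 h']]; first by exists s.
  exists (2^-1 * s'); last exact: innerS.
  by case/andP: s'01 => *; apply/andP; split; lra.
(* The points with such a representation form a convex set containing every [X n], hence the whole
   hull. *)
have : K `<=` [set y | K y /\ exists m s, 0 < s <= 1 /\ inner m s y].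
  apply: smallest_sub; last first.
    move=> _ [n _ <-]; split => //.
    exists n; case: n => [|n].
      by exists 1; split; [rewrite ltr01 lexx|exists (X 0%N);
        rewrite // scale1r subrr scale0r addr0].
    exists 2^-1; split; first by lra.
    exists (B n) => //=; rewrite addrC; congr (_ *: _ + _ *: _); lra.
  apply/convex_setP => x y s [Kx [m [a [a01 ma]]]] [Ky [n [b [b01 nb]]]] s01.
  split; first exact: cK.
  (* Two representations are combined once they share the same index, the larger one, and the same
     weight, the smaller one. *)
  have [a' a'01 ma'] := inner_mono _ _ _ _ (leq_maxl m n) a01 ma.
  have [b' b'01 nb'] := inner_mono _ _ _ _ (leq_maxr m n) b01 nb.
  exists (maxn m n), (Num.min a' b'); set c := Num.min a' b'.
  have c01 : 0 < c <= 1.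
    by case/andP: a'01 => ? ?; case/andP: b'01 => ? ?; rewrite lt_min ge_min;
      apply/andP; split; [apply/andP|apply/orP; left].
  split => //.
  have ca : 0 < c <= a' by case/andP: c01 => -> _; rewrite ge_min lexx.
  have cb : 0 < c <= b' by case/andP: c01 => -> _; rewrite ge_min lexx orbT.
  have [z Kz Bz] := inner_le _ _ _ _ Kx ca (andP a'01).2 ma'.
  have [w Kw Bw] := inner_le _ _ _ _ Ky cb (andP b'01).2 nb'.
  exists (s *: z + (1 - s) *: w); first exact: cK.
  have -> : B (maxn m n) = s *: B (maxn m n) + (1 - s) *: B (maxn m n).
    by rewrite -scalerDl addrC subrK scale1r.
  rewrite {1}Bz Bw !scalerDr !scalerA !(mulrC s) !(mulrC (1 - s)) -!addrA.
  by congr (_ + _); rewrite addrCA.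
move=> KS y /KS[_ [m [s [s01 [z Kz Bz]]]]].
by exists m, s, z.
Qed.

End convex_hulls.

(** * Almost sure form of the operations on [L0 P], and utility maximisers in convex
    neighbourhoods *)

Section L0_lemmas.
Context d (T : measurableType d) (R : realType) (P : probability T R).
Implicit Types (x y z : L0 P) (f g : T -> R) (s e r : R).

Lemma measurable_L0 x : measurable_fun setT (x : T -> R).
Proof. exact: measurable_funPT. Qed.

Lemma L0_conv_ae s x y : {ae P, forall t,
  (s *: x + (1 - s) *: y : L0 P) t = s * x t + (1 - s) * y t}.
Proof.
have hD := L0_piE P (repr (s *: x) + repr ((1 - s) *: y)).
have hx := L0_piE P (s *: repr x); have hy := L0_piE P ((1 - s) *: repr y).
move: hD; apply: filterS3 hx hy => t /(_ I) hx /(_ I) hy /(_ I) hD.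
by apply: etrans hD _; congr (_ + _).
Qed.

Lemma L0_add_ae x y : {ae P, forall t, (x + y : L0 P) t = x t + y t}.
Proof.
move: (L0_piE P (repr x + repr y)); apply: filterS => t /(_ I) h.
exact: etrans h _.
Qed.

Lemma L0_zero_ae : {ae P, forall t, (0 : L0 P) t = 0}.
Proof.
move: (L0_piE P 0); apply: filterS => t /(_ I) h.
exact: etrans h _.
Qed.

Lemma measurable_dist_ge f g e :
  measurable_fun setT f -> measurable_fun setT g ->
  measurable [set t | e <= `|f t - g t|].
Proof.
move=> mf mg; rewrite -[X in measurable X]setTI;
  apply: (measurable_fun_le _ _) => //.
by apply: measurableT_comp => //; exact: measurable_funB.
Qed.

Lemma le_measure_ae (A B : set T) : measurable A -> measurable B ->
  {ae P, forall t, A t -> B t} -> (P A <= P B)%E.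
Proof.
move=> mA mB AB.
have PE B' : measurable B' -> P B' = (\int[P]_t (\1_B' t)%:E)%E.
  by move=> mB'; rewrite integral_indic// setIT.
rewrite (PE _ mA) (PE _ mB).
apply: ae_ge0_le_integral => //.
- exact/measurable_EFinP.
- exact/measurable_EFinP.
- move: AB; apply: filterS => t AB _; rewrite lee_fin !indicE.
  have [tA|_] := boolP (t \in A); last by rewrite ler0n.
  by rewrite mem_set//; apply: AB; exact: set_mem.
Qed.

Lemma nbhs_L0P x (A : set (L0 P)) :
  nbhs x A <-> exists2 e, 0 < e & forall y, L0_ball x e y -> A y.
Proof.
split=> [/nbhs_ballP[e /= e0 xA]|[e e0 xA]].
  by exists e => // y /xA.
by apply/nbhs_ballP; exists e => // y /xA.
Qed.

(* [`|y|] serves as an everywhere nonnegative representative of [y]. *)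
Lemma L0_norm_ae y : {ae P, forall t, 0 <= y t} ->
  {ae P, forall t, `|y t| = y t}.
Proof. by apply: filterS => t y0; rewrite ger0_norm. Qed.

(** Local convexity enters the construction here: a convex neighbourhood of [x] inside the ball of
    radius [e] is given to [exists_utility_maximizer]. It contains all points of [K] within some [r]
    of [x], so the resulting estimate is uniform near [x]. *)
Lemma locally_convex_maximizer (K : set (L0 P)) x (M e : R) :
  (forall y, K y -> {ae P, forall t, 0 <= y t}) ->
  (forall y, K y -> (\int[P]_t (`|y t|)%:E <= M%:E)%E) ->
  K x -> L0_locally_convex_at K x -> 0 < e ->
  exists Z : T -> R, [/\ measurable_fun setT Z, forall t, 0 <= Z t,
    (\int[P]_t (Z t)%:E <= M%:E)%E &
    exists2 r, 0 < r & forall y, K y -> L0_ball x r y ->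
      (\int[P]_t ((1 + `|y t|) / (1 + Z t) ^+ 2)%:E <=
       \int[P]_t ((1 + `|x t|) / (1 + Z t) ^+ 2)%:E + (4 * e)%:E)%E].
Proof.
move=> K0 KM Kx /(_ (L0_ball 0 e)) xK e0.
have [W [cW nW sW]] : exists W : set (L0 P), [/\ convex_set W,
  within K (nbhs x) W &
      W `<=` [set x + u | u in L0_ball 0 e] `&` K].
  by apply: xK; apply/nbhs_L0P; exists e.
have /nbhs_L0P[r r0 rW] := nW.
have WK y : W y -> K y by case/sW.
pose W' := [set f : T -> R | [/\ measurable_fun setT f, forall t, 0 <= f t &
  exists2 y, W y & {ae P, forall t, f t = y t}]].
have norm_W' y : W y -> W' (fun t => `|y t|).
  move=> Wy; split.
  - by apply: measurableT_comp => //; exact: measurable_L0.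
  - by [].
  - by exists y => //; exact/L0_norm_ae/K0/WK.
have Wx : W x.
  apply: rW => //;
    rewrite /L0_ball [X in P X](_ : _ = set0) ?measure0 ?lte_fin//.
  by apply/seteqP; split => t //=; rewrite subrr normr0 leNgt r0.
have [f|f|f g s|f|f|Z [mZ Z0 ZM Zle]] :=
  @exists_utility_maximizer _ _ _ P W' _ _ _
    (fun t => `|x t|) M e (norm_W' _ Wx) (ltW e0).
- by case.
- by case.
- move=> [mf f0 [y Wy fy]] [mg g0 [z Wz gz]] /andP[s0 s1]; split.
  + by apply: measurable_funD; exact: measurable_funM.
  + by move=> t; rewrite addr_ge0// mulr_ge0// subr_ge0.
  + exists ((1 - s) *: y + (1 - (1 - s)) *: z).
      by move/convex_setP : cW; apply => //; apply/andP; split; lra.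
    apply: filterS3 fy gz (L0_conv_ae (1 - s) y z) => t -> -> ->.
    by congr (_ + _ * _); ring.
- move=> [mf f0 [y Wy fy]].
  apply: le_trans (KM _ (WK _ Wy)); apply: ae_ge0_le_integral => //.
  + by move=> t _; rewrite lee_fin.
  + exact/measurable_EFinP.
  + apply/measurable_EFinP/measurableT_comp => //; exact: measurable_L0.
  + by move: fy; apply: filterS => t -> _; rewrite lee_fin ler_norm.
- move=> [mf f0 [y Wy fy]].
  have [[u eu xu] _] := sW _ Wy.
  apply: le_trans (ltW eu); apply: le_measure_ae.
  + apply: measurable_dist_ge => //; apply: measurableT_comp => //;
    exact: measurable_L0.
  + exact: measurable_L0_dist.
  + have : {ae P, forall t, (0 : L0 P) t = 0 /\ `|x t| = x t}.
      by apply: filterS2 L0_zero_ae (L0_norm_ae (K0 _ Kx)) => t.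
    apply: filterS3 fy (L0_add_ae x u) => t /= -> xut [-> ->].
    by rewrite -xu xut addrAC subrr add0r sub0r normrN.
exists Z; split => //; exists r => // y Ky ry.
by apply: Zle; apply: norm_W'; exact: rW.
Qed.

End L0_lemmas.

(** * One density giving continuity at every point of the hull *)

Section density_on_hull.
Context d (T : measurableType d) (R : realType) (P : probability T R).
Implicit Types (x y z : L0 P) (s e r M : R).

Lemma L0_ball_le x y r s : r <= s -> L0_ball x r y -> L0_ball x s y.
Proof.
rewrite /L0_ball => rs xy; apply: lt_le_trans (_ : (r%:E <= s%:E)%E);
  last by rewrite lee_fin.
apply: le_lt_trans xy; apply: le_measure; rewrite ?inE;
  try exact: measurable_L0_dist.
by move=> t /=; exact: le_trans.
Qed.

(** The maximiser depends on the point and on the precision, so there is one [Z j] for each pair of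
    them. The common density is dominated by the [j]-th weight up to the factor [4 ^+ j]. *)
Lemma locally_convex_density (K : set (L0 P)) (B : nat -> L0 P) M :
  (forall y, K y -> {ae P, forall t, 0 <= y t}) ->
  (forall y, K y -> (\int[P]_t (`|y t|)%:E <= M%:E)%E) ->
  (forall m, K (B m)) -> (forall m, L0_locally_convex_at K (B m)) ->
  exists g : T -> R, [/\ measurable_fun setT g, forall t, 0 <= g t <= 1,
    {ae P, forall t, 0 < g t} &
    forall m e, 0 < e -> exists2 r, 0 < r &
      forall y, K y -> L0_ball (B m) r y ->
      (\int[P]_t (g t * `|B m t - y t|)%:E <= e%:E)%E].
Proof.
move=> K0 KM KB lcB.
(* Decodes [j] into a point index and a precision index; the default pair is harmless, since only
   codes [pickle (m, k)] are used below. *)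
pose mk j : nat * nat := odflt (0, 0)%N (unpickle j).
(* The factor [4 ^- j] compensates in advance for the constant of the common density, leaving
   [2 ^- k]. *)
pose eps j : R := (4 ^+ j)^-1 * (2 ^+ (mk j).2)^-1.
have eps0 j : 0 < eps j by rewrite mulr_gt0// invr_gt0 exprn_gt0.
have /choice[Z HZ] := fun j =>
  locally_convex_maximizer K0 KM (KB (mk j).1) (lcB (mk j).1) (eps0 j).
have mZ j : measurable_fun setT (Z j) by case: (HZ j).
have Z0 j t : 0 <= Z j t by case: (HZ j).
have ZM j : (\int[P]_t (Z j t)%:E <= M%:E)%E by case: (HZ j).
have [g [mg g0 gpos gZ]] := exists_common_density mZ Z0 ZM.
have g1 t : g t <= 1.
  apply: le_trans (gZ 0%N t) _;
    rewrite expr0 mul1r invf_le1 ?exprn_gt0 ?ltr_pwDl//.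
  by rewrite exprn_ege1// lerDl.
exists g; split => // [t|m e e0]; first by rewrite g0 g1.
have [k ke] : exists k, 4 * (2 ^+ k)^-1 <= e / 2 :> R.
  have e80 : 0 <= 8 / e by rewrite divr_ge0// ltW.
  exists (Num.bound (8 / e)); have := archi_boundP e80;
    set k := Num.bound _ => h.
  have h2 : 8 / e <= 2 ^+ k.
    by apply: (le_trans (ltW h)); rewrite -natrX ler_nat ltnW// ltn_expl.
  rewrite ler_pdivrMr ?exprn_gt0//; move: h2; rewrite ler_pdivrMr//; lra.
pose j := pickle (m, k).
have mkj : mk j = (m, k) by rewrite /mk /j pickleK.
pose C : R := 4 ^+ j; have C0 : 0 < C by rewrite exprn_gt0.
have CE : C * (4 * eps j) = 4 * (2 ^+ k)^-1.
  by rewrite /eps mkj /= -/C mulrCA mulVKf ?gt_eqF.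
(* The negative part contributes [C * s + s] in [integral_dist_le]. Unlike [eps j], [s] may depend
   on [C]: it only shrinks the radius and leaves [Z j] unchanged. *)
pose s := e / 2 / (C + 1);
  have s0 : 0 < s by rewrite divr_gt0// ?divr_gt0// addr_gt0.
have sE : C * s + s = e / 2.
  by rewrite /s; field; rewrite gt_eqF// addr_gt0.
have mB x : measurable_fun setT (fun t => `|x t|).
  by apply: measurableT_comp => //; exact: measurable_L0.
have Bfin : (\int[P]_t (`|B m t|)%:E < +oo)%E
  by apply: le_lt_trans (KM _ (KB m)) (ltry _).
have [r1 r10 Hr1] := integral_neg_part_small (mB (B m)) (fun t =>
  normr_ge0 _) Bfin s0.
case: (HZ j) => _ _ _; rewrite mkj => -[r2 r20 Hr2].
exists (Num.min r1 r2); first by rewrite lt_min r10.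
move=> y Ky By.
have By1 : L0_ball (B m) r1 y by apply: L0_ball_le By; rewrite ge_min lexx.
have By2 : L0_ball (B m) r2 y by apply: L0_ball_le By; rewrite ge_min lexx orbT.
have neg : (\int[P]_t (Num.max (`|B m t| - `|y t|) 0)%:E <= s%:E)%E.
  apply: Hr1 => //; apply: le_lt_trans By1; apply: le_measure; rewrite ?inE.
  - exact: measurable_dist_ge.
  - exact: measurable_L0_dist.
  - by move=> t /= /le_trans; apply; rewrite distrC ler_dist_dist.
have := integral_dist_le (mB y) (fun t => normr_ge0 _) (mB (B m)) (fun t =>
  normr_ge0 _)
  mg _ (mZ j) (Z0 j) (ltW C0) (gZ j) Bfin (Hr2 _ Ky By2) neg.
move=> /(_ _)/wrap[]; first by move=> t; rewrite g0 g1.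
move=> h; apply: (@le_trans _ _ (C * (4 * eps j + s) + s)%:E); last first.
  by rewrite lee_fin mulrDr CE -addrA sE; lra.
apply: le_trans h; apply: ae_ge0_le_integral => //.
- by move=> t _; rewrite lee_fin mulr_ge0.
- apply/measurable_EFinP; apply: measurable_funM => //;
  apply: measurableT_comp => //.
  by apply: measurable_funB; exact: measurable_L0.
- by move=> t _; rewrite lee_fin mulr_ge0.
- apply/measurable_EFinP; apply: measurable_funM => //;
  apply: measurableT_comp => //.
  exact: measurable_funB.
- move: (L0_norm_ae (K0 _ Ky)) (L0_norm_ae (K0 _ (KB m))).
  by apply: filterS2 => t -> -> _; rewrite lee_fin distrC.
Qed.

(** Write [B m = s *: y + (1 - s) *: w]. The map sending [z] to [s *: z + (1 - s) *: w] preserves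
    [K], takes [y] to [B m] and multiplies distances by [s], so continuity at [B m] with precision
    [s * e] gives continuity at [y] with precision [e]. *)
Lemma locally_convex_hull_density (X : nat -> L0 P) M
    (K := convex_hull (range X)) :
  (forall y, K y -> {ae P, forall t, 0 <= y t}) ->
  (forall y, K y -> (\int[P]_t (`|y t|)%:E <= M%:E)%E) ->
  L0_locally_convex_on K ->
  exists g : T -> R, [/\ measurable_fun setT g, forall t, 0 <= g t <= 1,
    {ae P, forall t, 0 < g t} &
    forall y e, K y -> 0 < e -> exists2 r, 0 < r &
      forall z, K z -> L0_ball y r z ->
      (\int[P]_t (g t * `|y t - z t|)%:E <= e%:E)%E].
Proof.
move=> K0 KM lcK.
have [B [KB Binner]] := convex_hull_barycenter X.
have [g [mg g01 gpos gB]] := locally_convex_density K0 KM KB (fun m =>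
  lcK _ (KB m)).
have /convex_setP cK : convex_set K by exact: convex_hull_convex.
exists g; split => // y e Ky e0.
have [m [s [w [/andP[s0 s1] Kw Bm]]]] := Binner _ Ky.
have [r r0 Hr] := gB m (s * e) (mulr_gt0 s0 e0).
exists r => // z Kz yz.
have Ksz : K (s *: z + (1 - s) *: w) by apply: cK => //; rewrite ltW.
have distE : {ae P, forall t,
    `|(B m : L0 P) t - (s *: z + (1 - s) *: w : L0 P) t| = s * `|y t - z t|}.
  move: (L0_conv_ae s y w) (L0_conv_ae s z w); rewrite -Bm.
  apply: filterS2 => t -> ->.
  by rewrite opprD addrACA subrr addr0 -mulrBr normrM gtr0_norm.
have ball : L0_ball (B m) r (s *: z + (1 - s) *: w).
  apply: le_lt_trans yz; apply: le_measure_ae; try exact: measurable_L0_dist.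
  move: distE; apply: filterS => t /= ->; move/le_trans; apply.
  by rewrite ler_piMl.
have := Hr _ Ksz ball.
rewrite (_ : (\int[P]_t _)%E = (s%:E * \int[P]_t (g t * `|y t - z t|)%:E)%E).
  by rewrite EFinM lee_pmul2l// lte_fin.
have mgd (u v : L0 P) : measurable_fun setT (fun t => (g t * `|u t - v t|)%:E).
  apply/measurable_EFinP; apply: measurable_funM => //;
    apply: measurableT_comp => //.
  by apply: measurable_funB; exact: measurable_L0.
have g0 t : 0 <= g t by case/andP: (g01 t).
rewrite -ge0_integralZl//; first last.
- by rewrite lee_fin ltW.
- by move=> t _; rewrite lee_fin mulr_ge0.
apply: ge0_ae_eq_integral => //.
- exact: emeasurable_funM.
- by move=> t _; rewrite lee_fin mulr_ge0.
- by move=> t _; rewrite -EFinM lee_fin !mulr_ge0// ltW.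
- by move: distE; apply: filterS => t -> _; rewrite -EFinM mulrCA.
Qed.

End density_on_hull.

(** * Comparison of the two topologies on a set *)

Section L0_L1.
Context d (T : measurableType d) (R : realType) (P : probability T R).
Implicit Types (x y z : L0 P) (s e r : R).

Lemma measurable_L0_distE x y :
  measurable_fun setT (fun t => (`|x t - y t|)%:E).
Proof.
apply/measurable_EFinP; apply: measurableT_comp => //.
by apply: measurable_funB; exact: measurable_L0.
Qed.

(** Gives the convexity of balls in the [L1] norm; [C] is an extended real so that it can be the
    maximum of two integrals. *)
Lemma le_integral_convex (f f1 f2 : T -> R) s (C : \bar R) :
  measurable_fun setT f -> measurable_fun setT f1 -> measurable_fun setT f2 ->
  0 <= s <= 1 ->
  {ae P, forall t, `|f t| <= s * `|f1 t| + (1 - s) * `|f2 t|} ->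
  (\int[P]_t (`|f1 t|)%:E <= C)%E -> (\int[P]_t (`|f2 t|)%:E <= C)%E ->
  (\int[P]_t (`|f t|)%:E <= C)%E.
Proof.
move=> mf mf1 mf2 /andP[s0 s1] ff f1C f2C.
have s1' : 0 <= 1 - s by rewrite subr_ge0.
have mE (h : T -> R) : measurable_fun setT h ->
    measurable_fun setT (fun t => (`|h t|)%:E).
  by move=> mh; apply/measurable_EFinP; exact: measurableT_comp.
apply: (@le_trans _ _ (\int[P]_t (s%:E * (`|f1 t|)%:E +
  (1 - s)%:E * (`|f2 t|)%:E))%E).
  apply: ae_ge0_le_integral => //.
  - exact: mE.
  - by move=> t _; rewrite -!EFinM -EFinD lee_fin addr_ge0// mulr_ge0.
  - by apply: emeasurable_funD; apply: emeasurable_funM => //; exact: mE.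
  - by move: ff; apply: filterS => t ft _; rewrite -!EFinM -EFinD lee_fin.
rewrite ge0_integralD//; first last.
- by apply: emeasurable_funM => //; exact: mE.
- by move=> t _; rewrite -EFinM lee_fin mulr_ge0.
- by apply: emeasurable_funM => //; exact: mE.
- by move=> t _; rewrite -EFinM lee_fin mulr_ge0.
rewrite !ge0_integralZl//; try exact: mE.
have -> : C = (s%:E * C + (1 - s)%:E * C)%E.
  by rewrite -ge0_muleDl ?lee_fin// -EFinD addrC subrK mul1e.
by apply: leeD; rewrite lee_wpmul2l ?lee_fin.
Qed.

Lemma L0_ball_markov x y e r : 0 < e ->
  (\int[P]_t (`|x t - y t|)%:E < (e * r)%:E)%E ->
  (P [set t | (e <= `|x t - y t|)%R] < r%:E)%E.
Proof.
move=> e0; set A := [set t | _];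
  have mA : measurable A by exact: measurable_L0_dist.
move=> xy; suff : (e%:E * P A < (e * r)%:E)%E by rewrite EFinM lte_pmul2l.
apply: le_lt_trans xy.
have -> : P A = (\int[P]_t (\1_A t)%:E)%E by rewrite integral_indic// setIT.
rewrite -ge0_integralZl//; first last.
- by rewrite lee_fin ltW.
- exact/measurable_EFinP.
apply: ge0_le_integral => //.
- by move=> t _; rewrite -EFinM lee_fin mulr_ge0// ltW.
- by apply: emeasurable_funM => //; exact/measurable_EFinP.
- exact: measurable_L0_distE.
- move=> t _; rewrite -EFinM lee_fin indicE.
  by have [/set_mem tA|_] := boolP (t \in A); rewrite ?mulr1// mulr0.
Qed.

Lemma L1_ballE (f g : L1 P) e :
  L1_ball f e g <-> (\int[P]_t (`|(f : L0 P) t - (g : L0 P) t|)%:E < e%:E)%E.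
Proof. by rewrite /L1_ball Lnorm1. Qed.

Lemma nbhs_L1P (f : L1 P) (A : set (L1 P)) :
  nbhs f A <-> exists2 e, 0 < e & forall g, L1_ball f e g -> A g.
Proof.
split=> [/nbhs_ballP[e /= e0 xA]|[e e0 xA]].
  by exists e => // y /xA.
by apply/nbhs_ballP; exists e => // y /xA.
Qed.

(** By Markov's inequality the [L1] topology is always at least as fine as the [L0] one, so only
    continuity in the other direction has to be assumed on [K]. *)
Lemma L0_L1_topologies_agree_suff (K : set (L0 P)) :
  (forall y, K y -> (\int[P]_t (`|y t|)%:E < +oo)%E) ->
  (forall y e, K y -> 0 < e -> exists2 r, 0 < r &
    forall z, K z -> L0_ball y r z ->
    (\int[P]_t (`|y t - z t|)%:E < e%:E)%E) ->
  L0_L1_topologies_agree K.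
Proof.
move=> Kfin Kcont.
have KL1 y : K y -> exists f : L1 P, (f : L0 P) = y.
  move=> Ky; have yL1 : (y : T -> R) \in Lfun P 1.
    apply/Lfun1_integrable/integrableP; split.
      by apply/measurable_EFinP; exact: measurable_L0.
    exact: Kfin.
  by exists (exist _ y yL1).
split; first by move=> y /KL1[f <-]; exists f.
move=> A; split.
- move=> [U oU ->]; exists [set f : L1 P | U (f : L0 P)]; last first.
    apply/seteqP; split => [y [Uy Ky]|_ [[f Uf <-] Kf]]; last by split.
    by split => //; have [f fy] := KL1 _ Ky; exists f => //=; rewrite fy.
  rewrite openE; suff : forall f : L1 P, U (f : L0 P) ->
    nbhs f [set f : L1 P | U (f : L0 P)] by [].
  move=> f Uf.
  have /nbhs_L0P[e e0 fU] : nbhs (f : L0 P) U by move: oU; rewrite openE; apply.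
  (* At this radius Markov's inequality gives probability below [e] for a deviation of at least
     [e]. *)
  apply/nbhs_L1P; exists (e * e); first by rewrite mulr_gt0.
  by move=> g /L1_ballE fg; apply: fU; exact: L0_ball_markov.
- move=> [V oV ->].
  (* The largest [L0]-open set whose trace on [K] lies in [V]; continuity on [K] shows that it
     reaches every point of that trace. *)
  exists (interior [set z | K z -> (@L1_L0 _ _ _ P @` V) z]).
    exact: open_interior.
  apply/seteqP; split => [y [[f Vf fy] Ky]|y [/interior_subset/= Vy Ky]];
    last first.
    by split => //; exact: Vy.
  split => //.
  have /nbhs_L1P[e e0 fV] : nbhs f V by move: oV; rewrite openE; apply.
  have [r r0 yr] := Kcont _ _ Ky e0.
  apply/nbhs_L0P; exists r => // z yz Kz.
  have [h hz] := KL1 _ Kz; exists h => //; apply: fV; apply/L1_ballE.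
  by rewrite hz fy; exact: yr.
Qed.

End L0_L1.

(** * Equivalent measures, and local convexity from agreement of the topologies *)

Section change_of_measure.
Context d (T : measurableType d) (R : realType) (P Q : probability T R).
Hypotheses (QP : Q `<< P) (PQ : P `<< Q).
Implicit Types (x y z : L0 P) (s e r : R).

Lemma null_dominates_ae (A : T -> Prop) :
  {ae P, forall t, A t} -> {ae Q, forall t, A t}.
Proof.
move=> [N [mN PN NA]]; exists N; split => //.
by move/null_content_dominatesP : QP; apply.
Qed.

Lemma L0_transfer_ae x : {ae Q, forall t, L0_transfer Q x t = x t}.
Proof. by move: (L0_piE Q (repr x)); apply: filterS => t; exact. Qed.

Lemma L0_transfer_distE x y : {ae Q, forall t,
  `|L0_transfer Q x t - L0_transfer Q y t| = `|x t - y t|}.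
Proof. by apply: filterS2 (L0_transfer_ae x) (L0_transfer_ae y) => t -> ->. Qed.

Lemma integral_L0_transfer_dist x y :
  (\int[Q]_t (`|L0_transfer Q x t - L0_transfer Q y t|)%:E =
   \int[Q]_t (`|x t - y t|)%:E)%E.
Proof.
apply: ge0_ae_eq_integral => //; try exact: measurable_L0_distE.
by move: (L0_transfer_distE x y); apply: filterS => t ->.
Qed.

Lemma integral_L0_transfer x :
  (\int[Q]_t (`|L0_transfer Q x t|)%:E = \int[Q]_t (`|x t|)%:E)%E.
Proof.
apply: ge0_ae_eq_integral => //.
- by apply/measurable_EFinP/measurableT_comp => //; exact: measurable_L0.
- by apply/measurable_EFinP/measurableT_comp => //; exact: measurable_L0.
by move: (L0_transfer_ae x); apply: filterS => t ->.
Qed.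

Lemma L0_ball_transfer_measure x y r (s : \bar R) :
  (Q [set t | (r <= `|L0_transfer Q x t - L0_transfer Q y t|)%R] < s)%E <->
  (Q [set t | (r <= `|x t - y t|)%R] < s)%E.
Proof.
suff -> : Q [set t | (r <= `|L0_transfer Q x t - L0_transfer Q y t|)%R] =
    Q [set t | (r <= `|x t - y t|)%R] by [].
apply/eqP; rewrite eq_le; apply/andP; split; apply: le_measure_ae;
  try exact: measurable_L0_dist;
  by move: (L0_transfer_distE x y); apply: filterS => t /= ->.
Qed.

(** A radius below [r] only enlarges the deviation event, and one below [s] makes its
    [P]-probability small enough for its [Q]-probability to be below [r]. *)
Lemma L0_ball_transfer r : 0 < r -> exists2 s, 0 < s &
  forall x y, L0_ball x s y -> L0_ball (L0_transfer Q x) r (L0_transfer Q y).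
Proof.
move=> r0; have [s s0 Hs] := null_dominates_eps_delta QP r0.
exists (Num.min r s); first by rewrite lt_min r0.
move=> x y xy; apply/L0_ball_transfer_measure; apply: Hs.
  exact: measurable_L0_dist.
apply: lt_le_trans (_ : ((Num.min r s)%:E <= s%:E)%E); last first.
  by rewrite lee_fin ge_min lexx orbT.
apply: le_lt_trans xy; apply: le_measure; rewrite ?inE;
  try exact: measurable_L0_dist.
by move=> t /=; apply: le_trans; rewrite ge_min lexx.
Qed.

Lemma L0_ball_of_transfer r : 0 < r -> exists2 s, 0 < s &
  forall x y, L0_ball (L0_transfer Q x) s (L0_transfer Q y) -> L0_ball x r y.
Proof.
move=> r0; have [s s0 Hs] := null_dominates_eps_delta PQ r0.
exists (Num.min r s); first by rewrite lt_min r0.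
move=> x y /L0_ball_transfer_measure xy; apply: Hs.
  exact: measurable_L0_dist.
apply: lt_le_trans (_ : ((Num.min r s)%:E <= s%:E)%E); last first.
  by rewrite lee_fin ge_min lexx orbT.
apply: le_lt_trans xy; apply: le_measure; rewrite ?inE;
  try exact: measurable_L0_dist.
by move=> t /=; apply: le_trans; rewrite ge_min lexx.
Qed.

(** The convex neighbourhoods are traces on [K] of [L1] balls for [Q]. Agreement of the topologies
    makes them [L0] neighbourhoods for [Q], hence for [P]; Markov's inequality makes them small. *)
Lemma topologies_agree_locally_convex (K : set (L0 P)) : convex_set K ->
  L0_L1_topologies_agree (@L0_transfer d T R P Q @` K) ->
  L0_locally_convex_on K.
Proof.
move=> /convex_setP cK [KL1 agree] x Kx U /nbhs_L0P[e e0 eU].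
have [r r0 Hr] := L0_ball_of_transfer e0.
pose D y : \bar R := (\int[Q]_t (`|x t - y t|)%:E)%E.
pose W := [set y | K y /\ (D y < (r * r)%:E)%E].
have rr0 : 0 < r * r by rewrite mulr_gt0.
exists W; split.
- apply/convex_setP => y z s [Ky Dy] [Kz Dz] s01; split; first exact: cK.
  apply: (@le_lt_trans _ _ (Order.max (D y) (D z))); last by rewrite gt_max Dy.
  have mxy (u : L0 P) : measurable_fun setT (fun t => x t - u t).
    by apply: measurable_funB; exact: measurable_L0.
  apply: (le_integral_convex (mxy _) (mxy y) (mxy z) s01).
  + move: (null_dominates_ae (L0_conv_ae s y z)); apply: filterS => t ->.
    rewrite (_ : _ - _ = s * (x t - (y : L0 P) t) + (1 - s)
      * (x t - (z : L0 P) t)); last by ring.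
    case/andP: s01 => s0 s1; apply: le_trans (ler_normD _ _) _.
    by rewrite !normrM (ger0_norm s0) [`|1 - s|]ger0_norm ?subr_ge0.
  + by rewrite le_max lexx.
  + by rewrite le_max lexx orbT.
- pose tx := L0_transfer Q x.
  have [f _ fx] : range (@L1_L0 _ _ _ Q) tx by apply: KL1; exists x.
  (* Agreement concerns open sets, so the ball is replaced by its interior, which still contains
     [f]. *)
  have [] := (agree (
     (@L1_L0 _ _ _ Q @` interior [set g | L1_ball f (r * r) g]) `&`
     (@L0_transfer d T R P Q @` K))).2 _.
    exists (interior [set g | L1_ball f (r * r) g]) => //; exact: open_interior.
  move=> V oV VE.
  have [] : (V `&` (@L0_transfer d T R P Q @` K)) tx.
    rewrite -VE; split; last by exists x.
    by exists f => //; apply: (nbhs_L1P f _).2; exists (r * r).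
  move=> Vtx _.
  have /nbhs_L0P[s s0 sV] : nbhs tx V by move: oV; rewrite openE; apply.
  have [q q0 Hq] := L0_ball_transfer s0.
  apply: (nbhs_L0P x _).2; exists q => // y xy Ky; split => //.
  have : (V `&` (@L0_transfer d T R P Q @` K)) (L0_transfer Q y).
    by split; [apply: sV; exact: Hq|exists y].
  rewrite -VE => -[[g /interior_subset/L1_ballE fg gy] _].
  by move: fg; rewrite fx gy integral_L0_transfer_dist.
- move=> y [Ky Dy]; split => //; exists (y - x); last by rewrite addrC subrK.
  apply: eU; have xy : L0_ball x e y.
    apply: Hr; apply: L0_ball_markov => //.
    by rewrite integral_L0_transfer_dist.
  apply: le_lt_trans xy; apply: le_measure_ae; try exact: measurable_L0_dist.
  have y_sub : {ae P, forall t, y t = (y - x : L0 P) t + x t}.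
    by move: (L0_add_ae (y - x) x); rewrite subrK.
  apply: filterS2 y_sub (L0_zero_ae P) => t /= -> ->.
  by rewrite sub0r normrN distrC addrK.
Qed.

End change_of_measure.

(** * The equivalence for the hull of a bounded nonnegative sequence *)

Theorem theorem1p7 (R : realType) (d : measure_display) (T : measurableType d)
    (P : probability T R) (X : nat -> L1 P)
    (P_nonatomic : nonatomic P)
    (X_ge0 : forall n, {ae P, forall t, 0 <= X n t})
    (X_bounded : exists M : R, forall n, ('N[P]_1[EFin \o X n] <= M%:E)%E) :
  let K : set (L0 P) := convex_hull (range (fun n => X n : L0 P)) in
  L0_locally_convex_on K <->
  exists Q : probability T R,
    [/\ Q `<< P, P `<< Q &
      L0_L1_topologies_agree (@L0_transfer d T R P Q @` K)].
Proof.
move=> K; split; last first.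
  move=> [Q [QP PQ agree]]; apply: topologies_agree_locally_convex agree => //.
  exact: convex_hull_convex.
move=> lcK.
have [M XM] := X_bounded.
(* Nonnegativity and the norm bound cut out a convex set, so they pass from the [X n] to the
   hull. *)
have KM : K `<=` [set y | {ae P, forall t, 0 <= y t} /\
    (\int[P]_t (`|y t|)%:E <= M%:E)%E].
  apply: smallest_sub.
    apply/convex_setP => y z s [y0 yM] [z0 zM] /[dup] s01 /andP[s0 s1].
    have s1' : 0 <= 1 - s by rewrite subr_ge0.
    split.
      apply: filterS3 y0 z0 (L0_conv_ae s y z) => t y0 z0 ->.
      by rewrite addr_ge0// mulr_ge0.
    apply: (le_integral_convex _ _ _ s01 _ yM zM); try exact: measurable_L0.
    move: (L0_conv_ae s y z); apply: filterS => t ->.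
    apply: le_trans (ler_normD _ _) _.
    by rewrite !normrM (ger0_norm s0) (ger0_norm s1').
  move=> _ [n _ <-]; split; first exact: X_ge0.
  by have := XM n; rewrite Lnorm1.
have [g [mg g01 gpos gcont]] := @locally_convex_hull_density _ _ _ P
  (fun n => X n : L0 P) M (fun y Ky => (KM y Ky).1) (fun y Ky =>
    (KM y Ky).2) lcK.
have g0 t : 0 <= g t by case/andP: (g01 t).
have g1 t : g t <= 1 by case/andP: (g01 t).
have [Q [QP PQ [c c0 Qint]]] := exists_density_probability mg g0 g1 gpos.
exists Q; split => //.
apply: L0_L1_topologies_agree_suff.
  move=> _ [y Ky <-]; rewrite integral_L0_transfer Qint; first last.
  - by [].
  - by apply: measurableT_comp => //; exact: measurable_L0.
  apply: lte_mul_pinfty; rewrite ?lee_fin ?ltW//.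
  apply: le_lt_trans (ltry M); apply: le_trans (KM _ Ky).2.
  have mEy : measurable_fun setT (fun t => `|y t|).
    by apply: measurableT_comp => //; exact: measurable_L0.
  apply: ge0_le_integral => //.
  - by move=> t _; rewrite lee_fin mulr_ge0.
  - by apply/measurable_EFinP; exact: measurable_funM.
  - exact/measurable_EFinP.
  - by move=> t _; rewrite lee_fin ler_piMl.
move=> _ e [y Ky <-] e0.
(* Dividing by [c] undoes the normalisation of [Q]; halving [e] makes the final inequality
   strict. *)
have e2c : 0 < e / 2 / c by rewrite !divr_gt0.
have [r r0 yr] := gcont _ _ Ky e2c.
have [s s0 Hs] := L0_ball_of_transfer PQ r0.
exists s => // _ [z Kz <-] yz.
rewrite integral_L0_transfer_dist Qint; first last.
- by [].
- by apply: measurableT_comp => //; apply: measurable_funB;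
  exact: measurable_L0.
apply: (@le_lt_trans _ _ (c%:E * (e / 2 / c)%:E)%E).
  by rewrite lee_pmul2l ?lte_fin//; apply: yr => //; exact: Hs.
by rewrite -EFinM lte_fin mulrC divfK ?gt_eqF// ltr_pdivrMr// ltr_pMr// ltr1n.
Qed.
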